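(* Let $D>0$, let $(\mathcal X,\|\cdot\|)$ be a $(2,D)$-smooth separable Banach space, let $f=(f_j)_{j\ge 0}\in\mathcal M(\mathcal X)$, and let $\lambda>0$ be such that $\mathbf E e^{\lambda\|d_j\|}<\infty$ for $j=1,2,\ldots$. Then for all $r\ge 0$, $$\mathbf{Pr}(f^*\ge r)\le 2e^{-\lambda r}\left\|\prod_{j=1}^\infty\left[1+D^2\,\mathbf E_{j-1}\left(e^{\lambda\|d_j\|}-1-\lambda\|d_j\|\right)\right]\right\|_\infty\le 2\exp\left\{-\lambda r+D^2\left\|\sum_{j=1}^\infty\mathbf E_{j-1}\left(e^{\lambda\|d_j\|}-1-\lambda\|d_j\|\right)\right\|_\infty\right\}.$$
   Context: A real Banach space $(\mathcal X,\|\cdot\|)$ is called $(2,D)$-smooth if $\|x+y\|^2+\|x-y\|^2\le 2\|x\|^2+2D^2\|y\|^2$ for all $x,y\in\mathcal X$. For a separable Banach space $\mathcal X$, $\mathcal M(\mathcal X)$ is the class of all martingales $f=(f_0,f_1,\ldots)$ of Bochner-integrable random vectors in $\mathcal X$ with $f_0\equiv 0$, defined on some probability space with respect to some filtration $(F_0,F_1,\ldots)$ (probability space and filtration may depend on $f$). Put $d_j=f_j-f_{j-1}$ for $j\ge1$, $f^*=\sup_{j\ge0}\|f_j\|$; $\mathbf E_{j-1}$ is the conditional expectation given $F_{j-1}$; $\|\cdot\|_\infty$ of a real random variable is its essential supremum norm (possibly $+\infty$). *)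

(* Defs.v *)
From HB Require Import structures.
From mathcomp Require Import all_boot all_order all_algebra.
From mathcomp Require Import all_classical all_reals all_analysis.
From mathcomp Require Import measurable_realfun.
Set Implicit Arguments.
Unset Strict Implicit.
Unset Printing Implicit Defensive.
Import Order.TTheory GRing.Theory Num.Theory.
Import numFieldNormedType.Exports.
Local Open Scope classical_set_scope.
Local Open Scope ring_scope.

Definition smooth2 (R : realType) (X : normedModType R) (D : R) : Prop :=
  forall x y : X,
    `|x + y| ^+ 2 + `|x - y| ^+ 2 <= 2 * `|x| ^+ 2 + 2 * D ^+ 2 * `|y| ^+ 2.

Definition separable (X : topologicalType) : Prop :=
  exists2 S : set X, countable S & dense S.

Definition borel (X : topologicalType) := g_sigma_algebraType (@open X).

(* Bochner integration of functions with values in a separable Banach space,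
   for which strong measurability is the same as Borel measurability. *)
Section bochner.
Context (R : realType) (X : completeNormedModType R).
Context (d : measure_display) (T : measurableType d).
Variable mu : {measure set T -> \bar R}.
Implicit Types (A : set T) (f : T -> X).

Definition bochner_simple (s : T -> X) : Prop :=
  measurable_fun [set: T] (s : T -> borel X) /\ finite_set (range s).

Definition bochner_simple_integral A (s : T -> X) : X :=
  \sum_(x \in range s) fine (mu (A `&` s @^-1` [set x])) *: x.

Definition bochner_approx A f (s : nat -> T -> X) : Prop :=
  (forall n, bochner_simple (s n)) /\
  (\int[mu]_(w in A) (`|f w - s n w|)%:E)%E @[n --> \oo] --> 0%E.

Definition bochner_integrable A f : Prop :=
  measurable_fun A (f : T -> borel X) /\ exists s, bochner_approx A f s.

(* The limit does not depend on the approximating sequence, so that on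
   Bochner-integrable functions this is the Bochner integral. *)
Definition bochner_integral A f : X :=
  xget 0 [set v | exists2 s, bochner_approx A f s &
                    bochner_simple_integral A (s n) @[n --> \oo] --> v].

End bochner.

Section conditional_expectation.
Context (R : realType) (d : measure_display) (T : measurableType d).
Variable P : probability T R.

Definition sub_sigma_algebra_of (G : set (set T)) : Prop :=
  sigma_algebra [set: T] G /\ G `<=` measurable.

(* Y is a version of the conditional expectation of the Banach-valued Z. *)
Definition is_bochner_cond_exp (X : completeNormedModType R)
    (G : set (set T)) (Z Y : T -> X) : Prop :=
  [/\ measurable_fun [set: g_sigma_algebraType G]
        (Y : g_sigma_algebraType G -> borel X),
      bochner_integrable P [set: T] Y &
      forall A, G A -> bochner_integral P A Y = bochner_integral P A Z].

Definition is_cond_exp (G : set (set T)) (Z Y : T -> R) : Prop :=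
  [/\ measurable_fun [set: g_sigma_algebraType G]
        (Y : g_sigma_algebraType G -> R),
      P.-integrable [set: T] (EFin \o Y) &
      forall A, G A -> (\int[P]_(w in A) (Y w)%:E = \int[P]_(w in A) (Z w)%:E)%E].

(* A version of E[Z | G]; it exists by cond_expP below and is unique up to a
   P-null set. *)
Definition cond_exp (G : set (set T)) (Z : T -> R) : T -> R :=
  xget (cst 0) [set Y | is_cond_exp G Z Y].

Lemma is_cond_exp_exists (G : set (set T)) (Z : T -> R) :
  sub_sigma_algebra_of G -> P.-integrable [set: T] (EFin \o Z) ->
  exists Y, is_cond_exp G Z Y.
Proof.
move=> [sG Gm] intZ.
have mZ : measurable_fun [set: T] (EFin \o Z).
  exact: measurable_int intZ.
have mG : @measurable _ (g_sigma_algebraType G) = G.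
  exact: measurable_g_measurableTypeE.
pose phi : T -> g_sigma_algebraType G := id.
have mphi : measurable_fun setT phi.
  by move=> _ A mA; rewrite setTI; apply: Gm; rewrite -mG.
pose phim : {mfun T >-> g_sigma_algebraType G} :=
  HB.pack phi (isMeasurableFun.Build _ _ _ _ phi mphi).
pose muG := distribution P phim.
have null A : measurable A -> muG A = 0%E -> induced_charge intZ (phim @^-1` A) = 0%E.
  move=> mA PA.
  have mA' : measurable (phim @^-1` A) by apply: Gm; move: mA; rewrite mG.
  apply: (null_set_integral mA' _ PA).
  exact: (measurable_funS measurableT (@subsetT _ _) mZ).
pose nu : {charge set (g_sigma_algebraType G) -> \bar R} :=
  measure_function_pushforward__canonical__charge_Charge (induced_charge intZ) mphi.
have numu : nu `<< muG by apply/null_content_dominatesP => A mA; exact: null.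
have RNi := Radon_Nikodym_integrable numu.
have RNE w : EFin (fine (Radon_Nikodym nu muG w)) = Radon_Nikodym nu muG w.
  by rewrite fineK// Radon_Nikodym_fin_num.
pose h : T -> \bar R := Radon_Nikodym nu muG \o phim.
have hE : EFin \o (fine \o Radon_Nikodym nu muG) = h.
  by apply/funext => w; exact: RNE.
have mRN := measurable_int _ RNi.
have mh : measurable_fun [set: T] h by exact: measurableT_comp mRN mphi.
have ih : P.-integrable [set: T] h.
  apply/integrableP; split => //.
  case/integrableP : RNi => _; rewrite ge0_integral_pushforward//.
  exact: measurableT_comp.
exists (fine \o Radon_Nikodym nu muG); split.
- exact: measurableT_comp.
- by rewrite hE.
- move=> A GA.
  have mA : @measurable _ (g_sigma_algebraType G) A by rewrite mG.
  transitivity (\int[P]_(w in phim @^-1` A) h w)%E.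
    by apply: eq_integral => w _; rewrite -hE.
  rewrite -[LHS]integral_pushforward//.
    exact: esym (Radon_Nikodym_integral numu mA).
  apply: integrableS ih => //; exact: Gm.
Qed.

Lemma cond_expP (G : set (set T)) (Z : T -> R) :
  sub_sigma_algebra_of G -> P.-integrable [set: T] (EFin \o Z) ->
  is_cond_exp G Z (cond_exp G Z).
Proof. by move=> sG iZ; apply: xgetPex; exact: is_cond_exp_exists. Qed.

End conditional_expectation.

Section martingale.
Context (R : realType) (X : completeNormedModType R).
Context (d : measure_display) (T : measurableType d).
Variable P : probability T R.

Definition filtration (F : nat -> set (set T)) : Prop :=
  (forall n, sub_sigma_algebra_of (F n)) /\
  (forall m n, (m <= n)%N -> F m `<=` F n).

Definition martingale (F : nat -> set (set T)) (f : nat -> T -> X) : Prop :=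
  [/\ filtration F,
      forall n, measurable_fun [set: g_sigma_algebraType (F n)]
                  (f n : g_sigma_algebraType (F n) -> borel X),
      forall n, bochner_integrable P [set: T] (f n) &
      forall n, is_bochner_cond_exp P (F n) (f n.+1) (f n)].

(* The class M(X): martingales starting at 0. *)
Definition martingale0 (F : nat -> set (set T)) (f : nat -> T -> X) : Prop :=
  martingale F f /\ forall w, f 0 w = 0.

End martingale.

(* d_j = f_j - f_(j-1), meaningful for j >= 1 (it is 0 for j = 0). *)
Definition mdiff (T : Type) (V : zmodType) (f : nat -> T -> V) (j : nat)
  (w : T) : V := f j w - f j.-1 w.

Definition maximal (R : realType) (V : normedModType R) (T : Type)
    (f : nat -> T -> V) (w : T) : \bar R :=
  ereal_sup (range (fun j => (`|f j w|)%:E)).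

(* E_(j-1) (e^(lambda |d_j|) - 1 - lambda |d_j|), for j >= 1. *)
Definition cond_excess (R : realType) (V : normedModType R)
    (d : measure_display) (T : measurableType d) (P : probability T R)
    (F : nat -> set (set T)) (f : nat -> T -> V) (lambda : R) (j : nat) :
    T -> R :=
  cond_exp P (F j.-1) (fun w =>
    expR (lambda * `|mdiff f j w|) - 1 - lambda * `|mdiff f j w|).

(* Main.v *)
From HB Require Import structures.
Require Import Defs.
From mathcomp Require Import all_boot all_order all_algebra.
From mathcomp Require Import finmap.
From mathcomp Require Import all_classical all_reals all_analysis.
From mathcomp Require Import measurable_realfun ess_sup_inf.
From mathcomp Require Import ring lra.
Set Implicit Arguments.
Unset Strict Implicit.
Unset Printing Implicit Defensive.
Import Order.TTheory GRing.Theory Num.Theory.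
Import numFieldNormedType.Exports.
Local Open Scope classical_set_scope.
Local Open Scope ring_scope.

(** The process [cosh (lambda * |f_n|) / W_n], where [W_n] is the product of
the factors [1 + D^2 * E_(j-1)(e^(lambda|d_j|) - 1 - lambda|d_j|)] for
[j <= n], is a nonnegative supermartingale starting at [1], and the theorem is
the maximal inequality for it: on the event that [|f_n|] exceeds [theta] the
process is at least [e^(lambda theta) / (2 W_n)], and [W_n] is almost surely
at most the essential supremum of the infinite product.  The second inequality
of the theorem is [1 + x <= e^x].

The supermartingale property rests on a deterministic estimate
([cosh_norm_expansion]): for each [x] there is a bounded linear functional [l]
with [cosh|x + v| <= cosh|x| + l v + D^2 (e^|v| - 1 - |v|) cosh|x|] for all
[v].  It is a second-order Taylor bound for [t |-> cosh|x + t v|], proved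
without derivatives.  Smoothness of the space bounds the second differences of
[cosh|.|] ([cosh_norm_second_difference]).  These bounds make the one-sided
directional derivative of the convex function [cosh|.|] at [x] linear, hence
they yield the subgradient [l] ([subgradient_of_smooth_convex]); summed twice
along a subdivision of the segment from [x] to [x + v] into [n] equal pieces,
they give the remainder term as [n] goes to infinity.

To take the conditional expectation at [x = f_(n-1)], [v = d_n] one needs the
linear term to vanish although [l] depends on [x].  For a fixed [x] it does,
because the Bochner integral commutes with bounded functionals
([bochner_integral_scalar]).  Since the space is separable, [f_(n-1)] can be
replaced, up to an error that costs a factor arbitrarily close to [1], by a
random vector with countably many values, and the inequality is then a
countable sum of inequalities with [x] fixed ([integral_cosh_step_le]).  The
same localization inserts the predictable weight [1 / W_n]
([le_integral_weight]). *)

(** * The hyperbolic cosine *)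

Section hyperbolic.
Context {R : realType}.
Implicit Types (s t c x y : R).

Definition cosh t : R := (expR t + expR (- t)) / 2.
Definition sinh t : R := (expR t - expR (- t)) / 2.

Lemma le_from_zero_of_derive (f df : R -> R) :
  (forall x, is_derive x 1 f (df x)) -> (forall x, 0 <= x -> 0 <= df x) ->
  forall x, 0 <= x -> f 0 <= f x.
Proof.
move=> fdf df0 x x0.
apply: (@ger0_derive1_ndecry _ f 0) => //.
- move=> y; rewrite in_itv/= andbT => /ltW y0.
  by rewrite derive1E; have [_ ->] := fdf y; exact: df0.
- apply: continuous_subspaceT => y.
  by apply/differentiable_continuous/derivable1_diffP; have [] := fdf y.
Qed.

(** The factor [1 / 2] must be sharp: it is what makes the constant in the
second difference of [cosh|.|] exactly [D^2]. *)
Lemma expR_taylor2_le s : expR s - 1 - s <= s ^+ 2 / 2 * expR `|s|.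
Proof.
have [s0|s0] := leP 0 s.
- rewrite ger0_norm//.
  pose f t : R := t ^+ 2 / 2 * expR t - expR t + 1 + t.
  have : f 0 <= f s.
    apply: (@le_from_zero_of_derive f
      (fun t => t ^+ 2 / 2 * expR t + (1 - expR t * (1 - t)))) => //.
      move=> x; rewrite /f; apply: is_derive_eq.
      by rewrite /GRing.scale/=; field.
    move=> x x0; rewrite addr_ge0 ?mulr_ge0 ?divr_ge0 ?expR_ge0 ?sqr_ge0//.
    by rewrite subr_ge0 -[leRHS](expRxMexpNx_1 x) ler_wpM2l ?expR_ge0 ?expR_ge1Dx.
  rewrite /f expR0; lra.
- have -> : s = - - s by rewrite opprK.
  have : 0 <= - s by lra.
  move: (- s) => t t0.
  rewrite normrN ger0_norm//.
  pose f t : R := t ^+ 2 / 2 - expR (- t) + 1 - t.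
  have : f 0 <= f t.
    apply: (@le_from_zero_of_derive f (fun t => t + (expR (- t) - 1))) => //.
      move=> x; rewrite /f; apply: is_derive_eq.
      by rewrite /GRing.scale/=; field.
    by move=> x x0; have := expR_ge1Dx (- x); lra.
  have : t ^+ 2 / 2 <= t ^+ 2 / 2 * expR t.
    by rewrite ler_peMr ?divr_ge0 ?sqr_ge0// -expR0 ler_expR.
  rewrite /f oppr0 expR0 sqrrN; lra.
Qed.

Lemma cosh0 : cosh 0 = 1. Proof. by rewrite /cosh oppr0 expR0; field. Qed.
Lemma sinh0 : sinh 0 = 0. Proof. by rewrite /sinh oppr0 expR0; field. Qed.

Lemma cosh_gt0 t : 0 < cosh t.
Proof. by rewrite /cosh divr_gt0// addr_gt0// expR_gt0. Qed.
Lemma cosh_ge0 t : 0 <= cosh t. Proof. exact/ltW/cosh_gt0. Qed.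

Lemma expR_le_cosh t : expR t / 2 <= cosh t.
Proof. by rewrite /cosh ler_pM2r// lerDl expR_ge0. Qed.

Lemma sinh_ge0 t : 0 <= t -> 0 <= sinh t.
Proof. by move=> t0; rewrite /sinh divr_ge0// subr_ge0 ler_expR; lra. Qed.

Lemma coshD s t : cosh (s + t) = cosh s * cosh t + sinh s * sinh t.
Proof. by rewrite /cosh /sinh opprD !expRD; field. Qed.

Lemma sinh_le_id_cosh t : 0 <= t -> sinh t <= t * cosh t.
Proof.
move=> t0; pose f t : R := t * cosh t - sinh t.
have : f 0 <= f t.
  apply: (@le_from_zero_of_derive f (fun t => t * sinh t)) => //.
    move=> x; rewrite /f /cosh /sinh; apply: is_derive_eq.
    by rewrite /GRing.scale/=; field.
  by move=> x x0; rewrite mulr_ge0// sinh_ge0.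
by rewrite /f sinh0; lra.
Qed.

(** Tangent lines stay below the graph; convexity and monotonicity of [cosh] are
read off from this. *)
Lemma cosh_taylor1_le c t : cosh c + sinh c * t <= cosh (c + t).
Proof.
rewrite /cosh /sinh opprD !expRD.
have h1 := ler_wpM2l (expR_ge0 c) (expR_ge1Dx t).
have h2 := ler_wpM2l (expR_ge0 (- c)) (expR_ge1Dx (- t)).
by lra.
Qed.

Lemma ge0_cosh_homo : {in Num.nneg &, {homo cosh : x y / x <= y}}.
Proof.
move=> x y; rewrite !nnegrE => x0 y0 xy.
have := cosh_taylor1_le x (y - x); rewrite subrKC.
have : 0 <= sinh x * (y - x) by rewrite mulr_ge0 ?sinh_ge0 ?subr_ge0.
lra.
Qed.

Lemma cosh_ge1 t : 1 <= cosh t.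
Proof. by have := cosh_taylor1_le 0 t; rewrite sinh0 cosh0 add0r mul0r addr0. Qed.

(** Only [cosh c], the value at the base point, enters the remainder; the factor
[expR d] tends to [1] when this is used on small steps. *)
Lemma cosh_taylor2_le c t d : `|t| <= d ->
  cosh (c + t) <= cosh c + sinh c * t + t ^+ 2 / 2 * (expR d * cosh c).
Proof.
move=> td; have tay s : `|s| <= d -> expR s - 1 - s <= s ^+ 2 / 2 * expR d.
  move=> sd; apply: le_trans (expR_taylor2_le s) _.
  by rewrite ler_wpM2l ?divr_ge0 ?sqr_ge0 ?ler_expR.
rewrite /cosh /sinh opprD !expRD.
have h1 := ler_wpM2l (expR_ge0 c) (tay _ td).
have := tay (- t); rewrite normrN => /(_ td) h.
have h2 := ler_wpM2l (expR_ge0 (- c)) h; move: h1 h2.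
by rewrite sqrrN; lra.
Qed.

Lemma cosh_add_le c t : 0 <= c -> 0 <= t ->
  cosh (c + t) <= cosh c * expR t.
Proof.
move=> c0 t0; rewrite coshD.
have -> : expR t = cosh t + sinh t by rewrite /cosh /sinh; field.
rewrite mulrDr lerD2l ler_wpM2r ?sinh_ge0//.
by rewrite /cosh /sinh ler_pM2r// lerD2l; have := expR_ge0 (- c); lra.
Qed.

Lemma cosh_convex s x y : 0 <= s <= 1 ->
  cosh (s * x + (1 - s) * y) <= s * cosh x + (1 - s) * cosh y.
Proof.
move=> /andP[s0 s1]; set z := s * x + _.
have h1 : s * (cosh z + sinh z * (x - z)) <= s * cosh x.
  by rewrite ler_wpM2l//; have := cosh_taylor1_le z (x - z); rewrite subrKC.
have h2 : (1 - s) * (cosh z + sinh z * (y - z)) <= (1 - s) * cosh y.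
  rewrite ler_wpM2l ?subr_ge0//.
  by have := cosh_taylor1_le z (y - z); rewrite subrKC.
apply: le_trans (lerD h1 h2); rewrite le_eqVlt; apply/orP; left; apply/eqP.
by rewrite /z; ring.
Qed.

End hyperbolic.

(** * Subgradients of smooth convex functions *)

(** The slopes [phi (t v) / t] decrease to the directional derivative [p v],
which is sublinear by convexity.  The quadratic bound forces [p (- v) = - p v], so
[p] is linear; it lies below [phi] because it is an infimum of slopes. *)
Lemma subgradient_of_smooth_convex (R : realType) (X : normedModType R)
    (phi : X -> R) (C : R) :
  phi 0 = 0 ->
  (forall s u v, 0 <= s <= 1 ->
    phi (s *: u + (1 - s) *: v) <= s * phi u + (1 - s) * phi v) ->
  (forall v, `|v| <= 1 -> phi v + phi (- v) <= C * `|v| ^+ 2) ->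
  exists l : {scalar X}, forall v, l v <= phi v.
Proof.
move=> phi0 phi_cvx phi_smooth.
pose slope v t := phi (t *: v) / t.
pose p v := inf [set slope v t | t in [set t | 0 < t]].
have slope_mono v s t : 0 < s -> s <= t -> slope v s <= slope v t.
  move=> s0 st; have t0 : 0 < t by exact: lt_le_trans st.
  rewrite /slope ler_pdivrMr//.
  have := phi_cvx (s / t) (t *: v) 0; rewrite scaler0 addr0 phi0 mulr0 addr0.
  rewrite scalerA divfK ?gt_eqF// => le; apply: le_trans (le _) _.
    by rewrite divr_ge0 ?(ltW s0) ?(ltW t0)//= ler_pdivrMr// mul1r.
  by rewrite le_eqVlt; apply/orP; left; apply/eqP; field; rewrite gt_eqF.
have slope_lb v t : 0 < t -> - phi (- v) <= slope v t.
  move=> t0; rewrite /slope ler_pdivlMr//.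
  have t1 : 0 < 1 + t by lra.
  have := phi_cvx (1 + t)^-1 (t *: v) (- v).
  have -> : 1 - (1 + t)^-1 = (1 + t)^-1 * t by field; rewrite gt_eqF.
  rewrite -scalerA scalerN -scalerDr subrr scaler0 phi0 -mulrA -mulrDr.
  rewrite invr_ge0 (ltW t1)/= invf_le1// lerDl => /(_ (ltW t0)).
  by rewrite pmulr_rge0 ?invr_gt0//; lra.
have p_le v t : 0 < t -> p v <= slope v t.
  move=> t0; apply: ge_inf; last by exists t.
  by exists (- phi (- v)) => _ [s /= s0 <-]; exact: slope_lb.
have le_p v c : (forall t, 0 < t -> c <= slope v t) -> c <= p v.
  move=> h; apply: lb_le_inf; first by exists (slope v 1), 1 => /=.
  by move=> _ [s /= s0 <-]; exact: h.
have pD u v : p (u + v) <= p u + p v.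
  rewrite -lerBlDr; apply: (le_p) => s s0; rewrite lerBlDr [leRHS]addrC -lerBlDr.
  apply: (le_p) => t t0; rewrite lerBlDr.
  (* both slopes may be compared at the common step [m], and convexity between
     [m *: u] and [m *: v] then bounds the slope of [u + v] at [m / 2] *)
  pose m := Num.min s t.
  have m0 : 0 < m by rewrite lt_min s0.
  have ms : m <= s by rewrite ge_min lexx.
  have mt : m <= t by rewrite ge_min lexx orbT.
  apply: le_trans (lerD (slope_mono v _ _ m0 mt) (slope_mono u _ _ m0 ms)).
  apply: le_trans (p_le _ (m / 2) _) _; first by rewrite divr_gt0.
  rewrite /slope -mulrDl.
  have := phi_cvx (1 / 2) (m *: v) (m *: u).
  have -> : 1 - 1 / 2 = 1 / 2 :> R by field.
  rewrite -scalerDr -(scalerDr m) [v + u]addrC scalerA => h.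
  have -> : m / 2 *: (u + v) = 1 / 2 * m *: (u + v) by congr (_ *: _); field.
  have -> : phi (1 / 2 * m *: (u + v)) / (m / 2) =
      (2 * phi (1 / 2 * m *: (u + v))) / m by field; rewrite gt_eqF.
  rewrite ler_pM2r ?invr_gt0//.
  have h01 : 0 <= (1 / 2 : R) <= 1 by apply/andP; split; lra.
  have := h h01; lra.
have p0 : p 0 = 0.
  apply/eqP; rewrite eq_le; apply/andP; split.
    by apply: le_trans (p_le _ 1 _) _; rewrite // /slope scaler0 phi0 mul0r.
  by apply: (le_p) => t t0; rewrite /slope scaler0 phi0 mul0r.
have pN v : p (- v) = - p v.
  apply/eqP; rewrite eq_le; apply/andP; split; last first.
    by have := pD v (- v); rewrite addrN p0; lra.
  rewrite -subr_le0 opprK; apply/ler_addgt0Pr => e e0; rewrite add0r.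
  (* small enough for the quadratic bound to apply to [t *: v], and for that
     bound divided by [t] to be at most [e] *)
  pose t := Num.min (1 + `|v|)^-1 (e / (1 + `|C| * `|v| ^+ 2)).
  have v1 : 0 < 1 + `|v| by rewrite ltr_wpDr.
  have C1 : 0 < 1 + `|C| * `|v| ^+ 2.
    by rewrite ltr_wpDr ?mulr_ge0 ?exprn_ge0.
  have t0 : 0 < t by rewrite lt_min invr_gt0 v1 divr_gt0.
  apply: le_trans (lerD (p_le _ _ t0) (p_le _ _ t0)) _.
  rewrite /slope -mulrDl ler_pdivrMr// scalerN addrC.
  have nt : `|t *: v| = t * `|v| by rewrite normrZ gtr0_norm.
  apply: le_trans (phi_smooth _ _) _; rewrite nt.
    have : t <= (1 + `|v|)^-1 by rewrite ge_min lexx.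
    rewrite -div1r ler_pdivlMr// mulrDr mulr1; lra.
  have : t <= e / (1 + `|C| * `|v| ^+ 2) by rewrite ge_min lexx orbT.
  rewrite ler_pdivlMr// mulrDr mulr1 => h.
  have -> : C * (t * `|v|) ^+ 2 = t * (C * `|v| ^+ 2) * t by ring.
  rewrite ler_pM2r//; apply: le_trans h; apply: ler_wpDl; first exact: ltW.
  by rewrite ler_pM2l// ler_wpM2r ?sqr_ge0// ler_norm.
have pDE u v : p (u + v) = p u + p v.
  apply/eqP; rewrite eq_le pD/= -lerBrDr -pN.
  by rewrite -[X in p X <= _](addrK v u) pD.
have pZ a v : p (a *: v) = a * p v.
  have pos b w : 0 < b -> p (b *: w) = b * p w.
    have le c x : 0 < c -> c * p x <= p (c *: x).
      move=> c0; apply: (le_p) => t t0; rewrite -ler_pdivlMl//.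
      apply: le_trans (p_le _ _ (mulr_gt0 t0 c0)) _.
      rewrite /slope scalerA le_eqVlt; apply/orP; left; apply/eqP; field.
      by rewrite !gt_eqF.
    move=> b0; apply/eqP; rewrite eq_le le// andbT -ler_pdivrMl//.
    have := le b^-1 (b *: w); rewrite invr_gt0 => /(_ b0).
    by rewrite scalerA mulVf ?gt_eqF// scale1r.
  have [a0|a0|->] := ltgtP a 0; last by rewrite scale0r p0 mul0r.
    rewrite -[a]opprK scaleNr pN mulNr; congr (- _); apply: pos; lra.
  exact: pos.
pose lp := GRing.isLinear.Build R X R *%R p
  (fun a u v => etrans (pDE _ _) (congr1 (+%R^~ (p v)) (pZ a u))).
exists (HB.pack p lp : {scalar X}) => v /=.
by apply: le_trans (p_le v 1 _) _ => //; rewrite /slope scale1r divr1.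
Qed.

(** * Taylor bound for cosh of the norm in a smooth space *)

Section smooth_space.
Context (R : realType) (X : normedModType R) (D : R).
Hypotheses (D_gt0 : 0 < D) (X_smooth : smooth2 X D).

(** The constant of a nonzero smooth space is at least [1], by the defining
inequality at [x = 0]; in the zero space any positive [D] is allowed. *)
Lemma smooth2_constant_ge1 (u : X) : u != 0 -> 1 <= D.
Proof.
rewrite -normr_gt0 => u0; have := X_smooth 0 u.
rewrite add0r sub0r normrN normr0 expr0n/= mulr0 add0r => h.
rewrite leNgt; apply/negP => D1.
have u2 : 0 < `|u| ^+ 2 by rewrite exprn_gt0.
have : D ^+ 2 * `|u| ^+ 2 < `|u| ^+ 2.
  by rewrite gtr_pMl// expr_lt1// ltW.
by lra.
Qed.

(** With [a], [b], [c] the norms of [y + u], [y - u], [y] and [q = sinh c / c],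
the first-order term [sinh c * (a - c)] is [q / 2] times
[(a^2 - c^2) - (a - c)^2].  Smoothness controls the sum of the squares [a^2],
[b^2], and what is left is [(k - q) / 2] times [(a - c)^2 + (b - c)^2] with
[k = e^|u| cosh c].  As [q <= k], each square may be replaced by [|u|^2]; the
total is [q D^2 |u|^2 + (k - q) |u|^2], at most [k D^2 |u|^2] since
[1 <= D]. *)
Lemma cosh_norm_second_difference (y u : X) :
  cosh `|y + u| + cosh `|y - u| <=
  2 * cosh `|y| + D ^+ 2 * `|u| ^+ 2 * (expR `|u| * cosh `|y|).
Proof.
have [->|u0] := eqVneq u 0.
  by rewrite addr0 subr0 normr0 expr0n/= mulr0 mul0r addr0; lra.
have D1 := smooth2_constant_ge1 u0.
have := X_smooth y u.
set a := `|y + u|; set b := `|y - u|; set c := `|y|; set e := `|u| => abc.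
have c0 : 0 <= c by exact: normr_ge0.
have e0 : 0 <= e by exact: normr_ge0.
have D2 : 1 <= D ^+ 2 by rewrite expr_ge1// ltW.
have ac : `|a - c| <= e.
  apply: le_trans (ler_dist_dist _ _) _.
  by rewrite addrC addKr.
have bc : `|b - c| <= e.
  apply: le_trans (ler_dist_dist _ _) _.
  by rewrite addrC addKr normrN.
have Ta := cosh_taylor2_le c ac; have Tb := cosh_taylor2_le c bc.
rewrite !subrKC in Ta Tb.
set k := expR e * cosh c in Ta Tb *.
have k1 : 1 <= k.
  by rewrite /k -[leLHS]mulr1 ler_pM ?cosh_ge1// -expR0 ler_expR.
have a2 : (a - c) ^+ 2 <= e ^+ 2 by rewrite -real_normK ?num_real// lerXn2r ?nnegrE.
have b2 : (b - c) ^+ 2 <= e ^+ 2 by rewrite -real_normK ?num_real// lerXn2r ?nnegrE.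
(* at [c = 0] the quotient [q] is not available, but then [sinh c = 0] *)
have [c_eq0|c_neq0] := eqVneq c 0.
  move: Ta Tb a2 b2; rewrite c_eq0 sinh0 cosh0 !subr0 !mul0r => Ta Tb a2 b2.
  have h1 : a ^+ 2 * k <= e ^+ 2 * k by rewrite ler_wpM2r//; lra.
  have h2 : b ^+ 2 * k <= e ^+ 2 * k by rewrite ler_wpM2r//; lra.
  have h3 : 1 * (e ^+ 2 * k) <= D ^+ 2 * (e ^+ 2 * k).
    by rewrite ler_wpM2r// mulr_ge0 ?sqr_ge0//; lra.
  by lra.
have c_gt0 : 0 < c by rewrite lt_neqAle eq_sym c_neq0.
pose q := sinh c / c.
have q0 : 0 <= q by rewrite divr_ge0 ?sinh_ge0.
have qk : q <= k.
  rewrite ler_pdivrMr//; apply: le_trans (sinh_le_id_cosh c0) _.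
  rewrite mulrC ler_wpM2r// ler_peMl ?cosh_ge0// -expR0 ler_expR//.
have sq : sinh c = q * c by rewrite divfK.
have h1 : (k - q) * (a - c) ^+ 2 <= (k - q) * e ^+ 2 by rewrite ler_wpM2l// subr_ge0.
have h2 : (k - q) * (b - c) ^+ 2 <= (k - q) * e ^+ 2 by rewrite ler_wpM2l// subr_ge0.
have h3 : q * (a ^+ 2 + b ^+ 2) <= q * (2 * c ^+ 2 + 2 * D ^+ 2 * e ^+ 2).
  by rewrite ler_wpM2l.
have h4 : (k - q) * e ^+ 2 * 1 <= (k - q) * e ^+ 2 * D ^+ 2.
  by rewrite ler_wpM2l// mulr_ge0 ?sqr_ge0// subr_ge0.
rewrite sq in Ta Tb.
nra.
Qed.

Lemma cosh_norm_convex (x u v : X) (s : R) : 0 <= s <= 1 ->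
  cosh `|x + (s *: u + (1 - s) *: v)| <=
  s * cosh `|x + u| + (1 - s) * cosh `|x + v|.
Proof.
move=> /[dup] s01 /andP[s0 s1]; apply: le_trans (cosh_convex _ _ s01).
have s1' : 0 <= 1 - s by rewrite subr_ge0.
apply: ge0_cosh_homo; rewrite ?nnegrE//.
  by rewrite addr_ge0// mulr_ge0.
have -> : x + (s *: u + (1 - s) *: v) = s *: (x + u) + (1 - s) *: (x + v).
  by rewrite !scalerDr addrACA -scalerDl subrKC scale1r.
by apply: le_trans (ler_normD _ _) _; rewrite !normrZ (ger0_norm s0) (ger0_norm s1').
Qed.

Lemma cosh_norm_le (x v : X) : cosh `|x + v| <= cosh `|x| * expR `|v|.
Proof.
apply: le_trans (cosh_add_le (normr_ge0 _) (normr_ge0 _)).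
by apply: ge0_cosh_homo; rewrite ?nnegrE ?addr_ge0// ler_normD.
Qed.

Lemma cosh_norm_subgradient (x : X) : exists l : {scalar X},
  (exists C : R, forall v, `|l v| <= C * `|v|) /\
  forall v, cosh `|x| + l v <= cosh `|x + v|.
Proof.
pose phi v := cosh `|x + v| - cosh `|x|.
have [l lphi] : exists l : {scalar X}, forall v, l v <= phi v.
  apply: (@subgradient_of_smooth_convex _ _ _ (D ^+ 2 * (expR 1 * cosh `|x|))).
  - by rewrite /phi addr0 subrr.
  - move=> s u v s01; rewrite /phi; have := cosh_norm_convex x u v s01; lra.
  - move=> v v1; rewrite /phi; have := cosh_norm_second_difference x v.
    have : D ^+ 2 * `|v| ^+ 2 * (expR `|v| * cosh `|x|) <=
           D ^+ 2 * `|v| ^+ 2 * (expR 1 * cosh `|x|).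
      apply: ler_wpM2l; first by rewrite mulr_ge0 ?sqr_ge0.
      by apply: ler_wpM2r; rewrite ?cosh_ge0// ler_expR.
    lra.
exists l; split; last by move=> v; have := lphi v; rewrite /phi; lra.
exists (cosh `|x| * expR 1) => v.
have le1 w : `|w| = 1 -> l w <= cosh `|x| * expR 1.
  move=> w1; apply: le_trans (lphi w) _; rewrite /phi.
  by have := cosh_norm_le x w; rewrite w1; have := cosh_ge0 `|x|; lra.
have [->|v0] := eqVneq v 0; first by rewrite linear0 !normr0 mulr0.
have nv : 0 < `|v| by rewrite normr_gt0.
have lw w : `|w| = `|v| -> l w <= cosh `|x| * expR 1 * `|v|.
  move=> wv; rewrite -ler_pdivrMr// mulrC -[_ * l w]/(_ *: l w) -linearZ.
  by apply: le1; rewrite normrZ wv normfV normr_id mulVf ?gt_eqF.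
by rewrite ler_norml lw// andbT lerNl -linearN lw// normrN.
Qed.

(** With steps [h = 1 / n], the increments of [g k = cosh|x + k h v|] satisfy a
second-order recursion.  Its source term is dominated by a geometric
progression of ratio [Q = e^(h |v|)], because [h |v| <= Q - 1]; two telescoping
summations bound [g n] by the right-hand side with the remainder multiplied by
powers of [Q], which tend to [1]. *)
Lemma cosh_norm_expansion (x : X) : exists l : {scalar X},
  (exists C : R, forall v, `|l v| <= C * `|v|) /\
  forall v, cosh `|x + v| <= cosh `|x| + l v +
    D ^+ 2 * (expR `|v| - 1 - `|v|) * cosh `|x|.
Proof.
have [l [lC lsub]] := cosh_norm_subgradient x.
exists l; split => // v.
set m := `|v|; set K := cosh `|x|.
have K0 : 0 <= K by exact: cosh_ge0.
have A0 : 0 <= D ^+ 2 * K by rewrite mulr_ge0 ?sqr_ge0.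
pose q n := expR (m / n.+1%:R).
have step n : cosh `|x + v| <=
    K + l v + D ^+ 2 * K * (q n * (q n * (expR m - 1) - m)).
  set h : R := n.+1%:R^-1; have h0 : 0 < h by rewrite invr_gt0.
  pose e := h * m; have e0 : 0 <= e by rewrite mulr_ge0 ?(ltW h0)// normr_ge0.
  pose Q := expR e; have -> : q n = Q by rewrite /q /Q /e mulrC.
  have Q1 : 1 <= Q by rewrite -expR0 ler_expR.
  have eQ : e <= Q - 1 by have := expR_ge1Dx e; rewrite -/Q; lra.
  have eQk k : e * Q ^+ k <= Q ^+ k.+1 - Q ^+ k.
    rewrite exprS -[X in _ - X]mul1r -mulrBl ler_wpM2r// exprn_ge0//; lra.
  have DKQ0 : 0 <= D ^+ 2 * K * Q by rewrite mulr_ge0// (le_trans _ Q1).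
  pose g k := cosh `|x + (k%:R * h) *: v|.
  have nhv : `|h *: v| = e by rewrite normrZ gtr0_norm.
  have gQ k : g k <= K * Q ^+ k.
    apply: le_trans (cosh_norm_le _ _) _; rewrite normrZ normrM.
    by rewrite (ger0_norm (ler0n _ k)) (gtr0_norm h0) -(mulrA k%:R) expRM_natl.
  (* first summation; the initial increment [g 1 - g 0] is controlled by the
     subgradient applied to [- h v] *)
  have D0 k : g k.+1 - g k <= h * l v + D ^+ 2 * K * Q * (e * (Q ^+ k.+1 - 1)).
    elim: k => [|k IH].
      rewrite /g mul0r scale0r addr0 mul1r expr1.
      have := cosh_norm_second_difference x (h *: v).
      have := lsub (- (h *: v)); rewrite linearN linearZ/= nhv -/K -/Q => h1 h2.
      have : D ^+ 2 * K * Q * (e * e) <= D ^+ 2 * K * Q * (e * (Q - 1)).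
        by apply: ler_wpM2l => //; apply: ler_wpM2l.
      move: h1 h2; rewrite /GRing.scale/=; lra.
    have := cosh_norm_second_difference (x + (k.+1%:R * h) *: v) (h *: v).
    have -> : x + (k.+1%:R * h) *: v + h *: v = x + (k.+2%:R * h) *: v.
      by rewrite -addrA -scalerDl -[k.+2]addn1 natrD; congr (_ + _ *: _); ring.
    have -> : x + (k.+1%:R * h) *: v - h *: v = x + (k%:R * h) *: v.
      by rewrite -addrA -scalerBl -[k.+1]addn1 natrD; congr (_ + _ *: _); ring.
    rewrite nhv.
    rewrite -/Q -/(g k.+1) -/(g k.+2) -/(g k) => h1.
    have h2 : D ^+ 2 * e ^+ 2 * Q * g k.+1 <= D ^+ 2 * e ^+ 2 * Q * (K * Q ^+ k.+1).
      apply: ler_wpM2l (gQ _).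
      exact: mulr_ge0 (mulr_ge0 (sqr_ge0 _) (sqr_ge0 _)) (expR_ge0 _).
    have h3 : D ^+ 2 * K * Q * e * (e * Q ^+ k.+1) <=
              D ^+ 2 * K * Q * e * (Q ^+ k.+2 - Q ^+ k.+1).
      by apply: ler_wpM2l (eQk _); rewrite mulr_ge0.
    lra.
  (* second summation *)
  have Dk k : g k <= K + k%:R * (h * l v) +
      D ^+ 2 * K * Q * (Q * (Q ^+ k - 1) - k%:R * e).
    elim: k => [|k IH].
      by rewrite /g mul0r scale0r addr0 -/K; lra.
    have := D0 k.
    have : D ^+ 2 * K * Q * (e * Q ^+ k.+1) <=
           D ^+ 2 * K * Q * (Q ^+ k.+2 - Q ^+ k.+1).
      by apply: ler_wpM2l (eQk _).
    have -> : k.+1%:R = k%:R + 1 :> R by rewrite natr1.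
    rewrite !(exprS Q).
    move: (Q ^+ k) (k%:R : R) (g k) (g k.+1) (h * l v) (D ^+ 2 * K * Q) IH
      => P j gk gk1 hl A.
    clear; lra.
  have nh : n.+1%:R * h = 1 by rewrite mulfV.
  have := Dk n.+1; rewrite /g nh scale1r /Q -expRM_natl /e !mulrA nh !mul1r.
  by rewrite -!mulrA.
have q1 : q n @[n --> \oo] --> (1 : R).
  have h : m / n.+1%:R @[n --> \oo] --> m * 0 by apply: cvgMr; exact: cvg_harmonic.
  have := continuous_cvg _ (@continuous_expR R (m * 0)) h.
  by rewrite mulr0 expR0; apply.
have lim_rhs : (K + l v + D ^+ 2 * K * (q n * (q n * (expR m - 1) - m)))
    @[n --> \oo] --> K + l v + D ^+ 2 * K * (1 * (1 * (expR m - 1) - m)).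
  apply: cvgD; first exact: cvg_cst.
  apply: cvgMr; apply: cvgM => //; apply: cvgB; last exact: cvg_cst.
  exact: cvgMl.
have -> : K + l v + D ^+ 2 * (expR m - 1 - m) * K =
  K + l v + D ^+ 2 * K * (1 * (1 * (expR m - 1) - m)) by ring.
rewrite -(cvg_lim _ lim_rhs)//; apply: limr_ge; first by apply: cvgP lim_rhs.
by near do apply: step.
Unshelve. all: by end_near. Qed.

End smooth_space.

(** * Borel functions into a separable space *)

Section borel_measurability.
Context (R : realType) (X : normedModType R).
Context (d : measure_display) (T : measurableType d).
Implicit Types (f g : T -> X) (x : X).

Lemma open_measurable_borel (U : set X) : open U -> measurable (U : set (borel X)).
Proof. by move=> oU; exact: sub_sigma_algebra. Qed.

Lemma measurable_continuous_borel (phi : X -> R) : continuous phi ->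
  measurable_fun [set: borel X] (phi : borel X -> R).
Proof.
move=> /continuousP cphi; apply: (measurability _ (RGenOpens.measurableE R)).
move=> _ [_ [a [b ->] <-]]; rewrite setTI; apply: open_measurable_borel.
exact/cphi/interval_open.
Qed.

Lemma measurable_borel_set1 x : measurable ([set x] : set (borel X)).
Proof.
rewrite -[[set x]]setCK; apply: measurableC; apply: open_measurable_borel.
exact/closed_openC/accessible_closed_set1/hausdorff_accessible/norm_hausdorff.
Qed.

Lemma measurable_norm_sub_cst f x : measurable_fun setT (f : T -> borel X) ->
  measurable_fun setT (fun w => `|f w - x|).
Proof.
move=> mf; apply: (@measurableT_comp _ _ _ _ _ _ (fun y : borel X => `|(y : X) - x|)) mf.
apply: measurable_continuous_borel => y.
apply: (@continuous_comp _ _ _ (fun y => y - x) (@Num.norm _ X)).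
  by apply: cvgB; [exact: cvg_id|exact: cvg_cst].
exact: norm_continuous.
Qed.

Lemma separable_dense_seq : separable X ->
  exists s : nat -> X, forall x (e : R), 0 < e -> exists n, `|x - s n| < e.
Proof.
move=> [S /pfcard_geP[S0|[s]] dS].
  have [] := dS setT; [by exists 0|exact: openT|].
  by move=> x; rewrite S0 => -[].
exists s => x e e0.
have [] := dS (ball x e); [by exists x; exact: ballxx|exact: ball_open|].
move=> y [xy Sy]; have [n _ ny] := 'surj_s Sy.
by exists n; rewrite ny; move: xy; rewrite -ball_normE.
Qed.

(** The map [(x, y) |-> |x - y|] need not be measurable for the product of the
Borel sigma-algebras; for a separable space, [|f - g|] is the infimum of
[|f - s n| + |g - s n|] over a dense sequence [s]. *)
Lemma measurable_norm_sub f g : separable X ->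
  measurable_fun setT (f : T -> borel X) ->
  measurable_fun setT (g : T -> borel X) ->
  measurable_fun setT (fun w => `|f w - g w|).
Proof.
move=> /separable_dense_seq[s sP] mf mg.
pose h n w := `|f w - s n| + `|g w - s n|.
have hge w n : `|f w - g w| <= h n w.
  by rewrite /h (distrC (g w)); exact: ler_distD.
have -> : (fun w => `|f w - g w|) = (fun w => infs (h ^~ w) 0).
  apply/funext => w; apply/eqP; rewrite eq_le; apply/andP; split.
    apply: lb_le_inf; first by exists (h 0 w), 0.
    by move=> _ [n _ <-].
  apply/ler_addgt0Pr => e e0.
  have [n fn] := sP (f w) (e / 2) (divr_gt0 e0 (ltr0Sn _ 1)).
  apply: (@le_trans _ _ (h n w)).
    apply: ge_inf; last by exists n.
    by exists `|f w - g w| => _ [k _ <-].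
  have : `|g w - s n| <= `|f w - g w| + `|f w - s n|.
    by rewrite (distrC (f w) (g w)); exact: ler_distD.
  by rewrite /h; lra.
apply: measurable_fun_infs => [w _|n].
  by exists `|f w - g w| => _ [k _ <-].
by apply: measurable_funD; exact: measurable_norm_sub_cst.
Qed.

Lemma measurable_subr_cst f x : measurable_fun setT (f : T -> borel X) ->
  measurable_fun setT ((fun w => f w - x) : T -> borel X).
Proof.
move=> mf; apply: (@measurableT_comp _ _ _ _ _ _
  (fun y : borel X => (y : X) - x : borel X)) mf.
apply: (@measurability _ _ (borel X) (borel X) setT _ (@open X) erefl).
move=> _ [U oU <-]; rewrite setTI; apply: open_measurable_borel.
apply: (open_comp _ oU) => y _.
by apply: cvgB; [exact: cvg_id|exact: cvg_cst].
Qed.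

End borel_measurability.

(** * The Bochner integral and bounded functionals *)

Lemma near_lt_of_cvge0 (R : realType) (u : (\bar R)^nat) (e : R) :
  u n @[n --> \oo] --> 0%E -> 0 < e -> \forall n \near \oo, (u n < e%:E)%E.
Proof.
move=> u0 e0; apply: (u0 [set x | (x < e%:E)%E]); apply: open_nbhs_nbhs; split.
  exact: open_ereal_lt_ereal.
by rewrite /= lte_fin.
Qed.

Section bochner_theory.
Context (R : realType) (X : completeNormedModType R).
Context (d : measure_display) (T : measurableType d) (P : probability T R).
Implicit Types (A : set T) (f s : T -> X).

Lemma bochner_simple_preimage s x : bochner_simple s -> measurable (s @^-1` [set x]).
Proof.
by move=> [ms _]; rewrite -[_ @^-1` _]setTI; apply: ms => //; exact: measurable_borel_set1.
Qed.

(** The level sets of a simple function partition the domain.  The integrand is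
another function, so that the lemma can be iterated to obtain the common
partition of two simple functions. *)
Lemma integral_bochner_simple_partition A s (phi : T -> R) :
  measurable A -> bochner_simple s -> measurable_fun A phi ->
  (\int[P]_(w in A) (phi w)%:E =
   \sum_(x <- fset_set (range s)) \int[P]_(w in A `&` s @^-1` [set x]) (phi w)%:E)%E.
Proof.
move=> mA [ms fs] mphi; pose B x := s @^-1` [set x].
have AE : A = \big[setU/set0]_(x <- fset_set (range s)) (A `&` B x).
  rewrite -bigcup_seq; apply/seteqP; split=> [w Aw|w [x _ []]//].
  by exists (s w) => //=; rewrite in_fset_set// inE; exists w.
rewrite {1}AE integral_bigsetU_EFin//.
- by move=> x; apply: measurableI => //; exact: bochner_simple_preimage.
- by move=> x y _ _ [w [[_ /= <-] [_ /= <-]]].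
- by rewrite -AE; exact/measurable_EFinP.
Qed.

Lemma integral_bochner_simple_comp A s (phi : X -> R) :
  measurable A -> bochner_simple s -> measurable_fun A (phi \o s) ->
  (\int[P]_(w in A) (phi (s w))%:E =
   (\sum_(x <- fset_set (range s)) fine (P (A `&` s @^-1` [set x])) * phi x)%:E)%E.
Proof.
move=> mA ss mphi; rewrite (integral_bochner_simple_partition mA ss mphi).
rewrite -sumEFin; apply: eq_bigr => x _.
have mB : measurable (A `&` s @^-1` [set x]).
  by apply: measurableI => //; exact: bochner_simple_preimage.
transitivity (\int[P]_(w in A `&` s @^-1` [set x]) (cst (phi x)%:E w))%E.
  by apply: eq_integral => w; rewrite inE => -[_ /= ->].
by rewrite integral_cst// EFinM fineK ?fin_num_measure// muleC.
Qed.

Lemma probability_bochner_simple_partition A s : measurable A -> bochner_simple s ->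
  fine (P A) = \sum_(x <- fset_set (range s)) fine (P (A `&` s @^-1` [set x])).
Proof.
move=> mA ss; have := @integral_bochner_simple_comp A s (cst 1) mA ss (measurable_cst _).
rewrite (integral_cst P mA 1%:E) mul1e => ->.
by rewrite /=; apply: eq_bigr => x _; rewrite mulr1.
Qed.

Lemma bochner_simple_integralE A s : bochner_simple s ->
  bochner_simple_integral P A s =
  \sum_(x <- fset_set (range s)) fine (P (A `&` s @^-1` [set x])) *: x.
Proof. by move=> [_ fs]; rewrite /bochner_simple_integral fsbig_finite. Qed.

Hypothesis X_separable : separable X.

(** Both integrals are sums over the common partition of [s] and [s'], and there
the triangle inequality applies term by term. *)
Lemma bochner_simple_integral_dist A s s' :
  measurable A -> bochner_simple s -> bochner_simple s' ->
  ((`|bochner_simple_integral P A s - bochner_simple_integral P A s'|)%:E <=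
   \int[P]_(w in A) (`|s w - s' w|)%:E)%E.
Proof.
move=> mA ss ss'.
have mI (B : set T) (t : T -> X) x : measurable B -> bochner_simple t ->
    measurable (B `&` t @^-1` [set x]).
  by move=> mB st; apply: measurableI => //; exact: bochner_simple_preimage.
pose p x y := fine (P (A `&` s @^-1` [set x] `&` s' @^-1` [set y])).
rewrite !bochner_simple_integralE//.
have -> : \sum_(x <- fset_set (range s)) fine (P (A `&` s @^-1` [set x])) *: x =
  \sum_(x <- fset_set (range s)) \sum_(y <- fset_set (range s')) p x y *: x.
  apply: eq_bigr => x _; rewrite -scaler_suml; congr (_ *: _).
  exact: probability_bochner_simple_partition (mI _ _ _ _ _) _.
have -> : \sum_(y <- fset_set (range s')) fine (P (A `&` s' @^-1` [set y])) *: y =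
  \sum_(x <- fset_set (range s)) \sum_(y <- fset_set (range s')) p x y *: y.
  rewrite exchange_big/=; apply: eq_bigr => y _; rewrite -scaler_suml; congr (_ *: _).
  rewrite (probability_bochner_simple_partition (mI _ _ y mA ss') ss).
  by apply: eq_bigr => x _; rewrite /p setIAC.
rewrite -sumrB.
under eq_bigr => x _ do rewrite -sumrB.
under eq_bigr => x _ do under eq_bigr => y _ do rewrite -scalerBr.
have msub : measurable_fun setT (fun w => `|s w - s' w|).
  by apply: measurable_norm_sub => //; [case: ss|case: ss'].
have -> : (\int[P]_(w in A) (`|s w - s' w|)%:E =
  (\sum_(x <- fset_set (range s)) \sum_(y <- fset_set (range s')) p x y * `|x - y|)%:E)%E.
  rewrite (integral_bochner_simple_partition mA ss); last exact: measurable_funTS.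
  rewrite -sumEFin; apply: eq_bigr => x _.
  transitivity (\int[P]_(w in A `&` s @^-1` [set x]) (`|x - s' w|)%:E)%E.
    by apply: eq_integral => w; rewrite inE => -[_ /= ->].
  apply: (@integral_bochner_simple_comp _ s' (fun y => `|x - y|) (mI _ _ _ mA ss) ss').
  apply: measurable_funTS; under eq_fun do rewrite distrC.
  by apply: measurable_norm_sub_cst; case: ss'.
rewrite lee_fin; apply: le_trans (ler_norm_sum _ _ _) _; apply: ler_sum => x _.
apply: le_trans (ler_norm_sum _ _ _) _; apply: ler_sum => y _.
by rewrite normrZ ger0_norm// fine_ge0.
Qed.

Lemma bochner_approxS A f (s : nat -> T -> X) :
  measurable A -> measurable_fun setT (f : T -> borel X) ->
  bochner_approx P setT f s -> bochner_approx P A f s.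
Proof.
move=> mA mf [ss s0]; split => //.
apply: (squeeze_cvge _ (@cvg_cst _ 0%E _ _ _) s0).
near=> n; rewrite integral_ge0//=.
apply: ge0_subset_integral => //; apply/measurable_EFinP.
by apply: measurable_norm_sub => //; case: (ss n).
Unshelve. all: by end_near. Qed.

(** The integrals of the approximants form a Cauchy sequence, as
[|s n - s m| <= |f - s n| + |f - s m|]. *)
Lemma bochner_integral_exists A f (s : nat -> T -> X) : measurable A ->
  measurable_fun setT (f : T -> borel X) -> bochner_approx P A f s ->
  exists v : X, bochner_simple_integral P A (s n) @[n --> \oo] --> v.
Proof.
move=> mA mf [ss s0].
pose I n : X := bochner_simple_integral P A (s n).
suff /cauchy_cvg cI : cauchy (I @ \oo) by exists (lim (I @ \oo)).
have mfs n : measurable_fun setT (fun w => `|f w - s n w|).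
  by apply: measurable_norm_sub => //; case: (ss n).
apply/cauchy_ballP => e e0.
have [N _ hN] : \forall n \near \oo,
    (\int[P]_(w in A) (`|f w - s n w|)%:E < (e / 2)%:E)%E.
  by apply: near_lt_of_cvge0; rewrite // divr_gt0.
exists ([set I n | n in [set n | (N <= n)%N]],
        [set I n | n in [set n | (N <= n)%N]]) => /=.
  by split; exists N => // n /= Nn; exists n.
move=> [_ _] /= [[n Nn <-] [m Nm <-]]; rewrite -ball_normE /=.
rewrite -lte_fin; apply: le_lt_trans (bochner_simple_integral_dist mA (ss n) (ss m)) _.
have -> : e%:E = ((e / 2)%:E + (e / 2)%:E)%E by rewrite -EFinD -splitr.
apply: le_lt_trans (lteD (hN n Nn) (hN m Nm)).
rewrite -ge0_integralD//; [|exact/measurable_EFinP/measurable_funTS..].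
apply: ge0_le_integral => //.
- apply/measurable_EFinP/measurable_funTS/measurable_norm_sub => //.
    by case: (ss n).
  by case: (ss m).
- by apply: emeasurable_funD; exact/measurable_EFinP/measurable_funTS.
by move=> w _; rewrite -EFinD lee_fin (distrC (f w) (s n w)) ler_distD.
Qed.

Lemma bochner_integrable_norm f : bochner_integrable P setT f ->
  P.-integrable setT (fun w => (`|f w|)%:E).
Proof.
move=> [mf [s [ss s0]]].
have [N _ /(_ N (leqnn N)) hN] : \forall n \near \oo,
    (\int[P]_w (`|f w - s n w|)%:E < 1)%E.
  exact: near_lt_of_cvge0.
have mn g : measurable_fun setT (g : T -> borel X) -> measurable_fun setT (fun w => `|g w|).
  by move=> mg; under eq_fun do rewrite -[g _]subr0; exact: measurable_norm_sub_cst.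
have ms : measurable_fun setT (s N : T -> borel X) by case: (ss N).
have mfs : measurable_fun setT (fun w => `|f w - s N w|) by exact: measurable_norm_sub.
apply: (@le_integrable _ _ _ P setT _ _
   ((fun w => (`|f w - s N w|)%:E) \+ (fun w => (`|s N w|)%:E))%E) => //.
- exact/measurable_EFinP/mn.
- move=> w _; rewrite -EFinD !abse_EFin lee_fin normr_id ger0_norm ?addr_ge0//.
  by rewrite -{1}[f w](subrK (s N w)) ler_normD.
apply: integrableD => //.
  apply/integrableP; split; first exact/measurable_EFinP.
  under eq_integral do rewrite gee0_abs//; exact: lt_trans hN (ltry _).
apply/integrableP; split; first exact/measurable_EFinP/mn.
under eq_integral do rewrite gee0_abs//.
by rewrite (integral_bochner_simple_comp measurableT (ss N) (mn _ ms)) ltry.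
Qed.

Lemma bounded_scalar_continuous (l : {scalar X}) (C : R) :
  (forall v, `|l v| <= C * `|v|) -> continuous l.
Proof.
move=> lC; apply: bounded_linear_continuous; apply/linear_boundedP.
exists C; split; first exact: num_real.
by move=> M CM v; apply: le_trans (lC v) _; rewrite ler_wpM2r// ltW.
Qed.

Lemma integrable_bounded_scalar (l : {scalar X}) (C : R) f :
  (forall v, `|l v| <= C * `|v|) -> bochner_integrable P setT f ->
  P.-integrable setT (fun w => (l (f w))%:E).
Proof.
move=> lC fi; have cl := bounded_scalar_continuous lC.
apply: (@le_integrable _ _ _ P setT _ _ (fun w => C%:E * (`|f w|)%:E)%E) => //.
- apply/measurable_EFinP.
  by apply: (measurableT_comp (measurable_continuous_borel cl)); case: fi.
- by move=> w _; rewrite -EFinM !abse_EFin lee_fin (le_trans (lC _))// ler_norm.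
by apply: integrableZl => //; exact: bochner_integrable_norm.
Qed.

Lemma bochner_simple_integrable s : bochner_simple s -> bochner_integrable P setT s.
Proof.
move=> ss; split; first by case: ss.
exists (fun=> s); split => //; under eq_fun do under eq_integral do rewrite subrr normr0.
by rewrite integral0; exact: cvg_cst.
Qed.

(** The identity is immediate for the approximating simple functions, and both
sides pass to the limit: the left one by continuity of [l], the right one
because [|l (f - s n)| <= C |f - s n|]. *)
Lemma bochner_integral_scalar (l : {scalar X}) (C : R) A f :
  (forall v, `|l v| <= C * `|v|) -> measurable A ->
  bochner_integrable P setT f ->
  ((l (bochner_integral P A f))%:E = \int[P]_(w in A) (l (f w))%:E)%E.
Proof.
move=> lC mA fi; have [mf [s0 as0]] := fi.
have cl := bounded_scalar_continuous lC.
have [v0 hv0] := bochner_integral_exists mA mf (bochner_approxS mA mf as0).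
have [s [ss s_cvg] Is] : [set v | exists2 s, bochner_approx P A f s &
    bochner_simple_integral P A (s n) @[n --> \oo] --> v] (bochner_integral P A f).
  by apply: xgetPex; exists v0, s0 => //; exact: bochner_approxS.
set v := bochner_integral P A f in Is *.
have ml g : measurable_fun setT (g : T -> borel X) -> measurable_fun setT (fun w => l (g w)).
  exact: (measurableT_comp (measurable_continuous_borel cl)).
have ms n : measurable_fun setT (s n : T -> borel X) by case: (ss n).
have lI n : (l (bochner_simple_integral P A (s n)))%:E = (\int[P]_(w in A) (l (s n w))%:E)%E.
  rewrite (integral_bochner_simple_comp mA (ss n)); last exact/measurable_funTS/ml.
  rewrite bochner_simple_integralE// linear_sum; congr (_%:E).
  by apply: eq_bigr => x _; rewrite linearZ.
have lf_int : P.-integrable A (fun w => (l (f w))%:E).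
  by apply: integrableS (integrable_bounded_scalar lC fi).
have lim1 : l (bochner_simple_integral P A (s n)) @[n --> \oo] --> l v.
  exact: (continuous_cvg _ (cl v)).
set c := (\int[P]_(w in A) _)%E.
have c_fin : c \is a fin_num by exact: integrable_fin_num.
suff lim2 : l (bochner_simple_integral P A (s n)) @[n --> \oo] --> fine c.
  by rewrite -(fineK c_fin); congr (_%:E); exact: cvg_unique lim1 lim2.
have C1 : 0 < `|C| + 1 by rewrite ltr_wpDl.
apply/cvgrPdist_le => e e0.
have := near_lt_of_cvge0 s_cvg (divr_gt0 e0 C1); apply: filterS => n ne.
rewrite -lee_fin -abse_EFin EFinB fineK// lI.
have lsi : P.-integrable A (fun w => (l (s n w))%:E).
  by apply: integrableS (integrable_bounded_scalar lC (bochner_simple_integrable (ss n))).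
have mfs : measurable_fun setT (fun w => `|f w - s n w|) by exact: measurable_norm_sub.
rewrite -integralB//.
apply: le_trans (le_abse_integral _ _ _) _ => //.
  by apply: emeasurable_funB; [case/integrableP: lf_int|case/integrableP: lsi].
apply: (@le_trans _ _ (\int[P]_(w in A) ((`|C| + 1)%:E * (`|f w - s n w|)%:E))%E).
  apply: ge0_le_integral => //.
  - apply: measurableT_comp => //.
    by apply: emeasurable_funB; [case/integrableP: lf_int|case/integrableP: lsi].
  - by apply: measurable_funeM; exact/measurable_EFinP/measurable_funTS.
  move=> w _; rewrite -EFinB abse_EFin -EFinM lee_fin -linearB.
  apply: le_trans (lC _) _; rewrite ler_wpM2r//; have := ler_norm C; lra.
rewrite ge0_integralZl_EFin//; last exact/measurable_EFinP/measurable_funTS.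
by rewrite -lee_pdivlMl// -EFinM mulrC ltW.
Qed.

End bochner_theory.

(** * Comparing integrals over a sub-sigma-algebra *)

(** Lets multiplicative errors that can be made arbitrarily close to [1] be
discarded, also for infinite values. *)
Lemma lee_mul_gt1 (R : realType) (x y : \bar R) : (0 <= y)%E ->
  (forall c : R, 1 < c -> (x <= c%:E * y)%E) -> (x <= y)%E.
Proof.
move=> y0 xy; case: y y0 xy => [y| |] y0 xy; [|by rewrite leey|by []].
move: y0; rewrite lee_fin => y0; apply/lee_addgt0Pr => e e0.
have y1 : 0 < y + 1 by lra.
apply: le_trans (xy (1 + e / (y + 1)) _) _; first by rewrite ltrDl divr_gt0.
rewrite -EFinM -EFinD lee_fin mulrDl mul1r lerD2l.
by rewrite mulrAC ler_pdivrMr// ler_wpM2l ?(ltW e0)//; lra.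
Qed.

Section sub_sigma_algebra.
Context (R : realType) (d : measure_display) (T : measurableType d).
Variables (P : probability T R) (G : set (set T)).
Hypothesis sG : sub_sigma_algebra_of G.
Implicit Types A B : set T.

Lemma measurable_sub_sigma_algebra :
  @measurable _ (g_sigma_algebraType G) = G.
Proof. by case: sG => sGT _; exact: measurable_g_measurableTypeE. Qed.

Lemma sub_sigma_algebra_measurable A : G A -> measurable A.
Proof. by case: sG => _; apply. Qed.

Lemma measurable_fun_sub_sigma_algebra (d' : measure_display) (U : measurableType d')
    (h : T -> U) :
  measurable_fun [set: g_sigma_algebraType G] (h : g_sigma_algebraType G -> U) ->
  measurable_fun setT h.
Proof.
move=> mh _ B mB; apply: sub_sigma_algebra_measurable.
by rewrite -measurable_sub_sigma_algebra; exact: mh.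
Qed.

Lemma sub_sigma_algebraI A B : G A -> G B -> G (A `&` B).
Proof. by rewrite -measurable_sub_sigma_algebra; exact: measurableI. Qed.

(** A comparison on all sets of [G] may be checked on those contained in a piece
of a countable cover by sets of [G], since every set of [G] is a disjoint
countable union of such sets.  Choosing pieces on which a [G]-measurable
quantity is nearly constant lets that quantity be treated as a constant. *)
Lemma le_integral_of_countable_cover (B : nat -> set T) (u v : T -> R) :
  (forall w, 0 <= u w) -> (forall w, 0 <= v w) ->
  measurable_fun setT u -> measurable_fun setT v ->
  (forall n, G (B n)) -> (forall w, exists n, B n w) ->
  (forall n A, G A -> A `<=` B n ->
    (\int[P]_(w in A) (u w)%:E <= \int[P]_(w in A) (v w)%:E)%E) ->
  forall A, G A -> (\int[P]_(w in A) (u w)%:E <= \int[P]_(w in A) (v w)%:E)%E.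
Proof.
move=> u0 v0 mu mv GB coverB le_uv A GA.
have GC n : G (A `&` seqDU B n).
  apply: sub_sigma_algebraI => //; rewrite /seqDU -measurable_sub_sigma_algebra.
  apply: (@measurableD _ (g_sigma_algebraType G)).
    by rewrite measurable_sub_sigma_algebra.
  apply: (@bigsetU_measurable _ (g_sigma_algebraType G)) => k _.
  by rewrite measurable_sub_sigma_algebra.
have mC n := sub_sigma_algebra_measurable (GC n).
have AE : A = \bigcup_n (A `&` seqDU B n).
  rewrite -setI_bigcupr -seqDU_bigcup_eq; apply/seteqP; split => [w Aw|w []//].
  by split => //; have [n Bn] := coverB w; exists n.
have tC : trivIset setT (fun n => A `&` seqDU B n).
  exact: trivIset_setIl (@trivIset_seqDU _ B).
rewrite AE !ge0_integral_bigcup//; last 4 first.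
- by apply/measurable_EFinP/measurable_funTS.
- by move=> w _; rewrite lee_fin.
- by apply/measurable_EFinP/measurable_funTS.
- by move=> w _; rewrite lee_fin.
apply: lee_nneseries => [n _ _|n _].
  by apply: integral_ge0 => w _; rewrite lee_fin.
by apply: (le_uv n) => // w [_ []].
Qed.

(** Replaces conditioning by multiplication with a [G]-measurable weight: on the
piece where [h] lies between [c^-(n+1)] and [c^-n] the weight is constant up to
the factor [c]. *)
Lemma le_integral_weight (u v h : T -> R) :
  (forall w, 0 <= u w) -> (forall w, 0 <= v w) ->
  measurable_fun setT u -> measurable_fun setT v ->
  measurable_fun [set: g_sigma_algebraType G] (h : g_sigma_algebraType G -> R) ->
  (forall w, 0 < h w <= 1) ->
  (forall A, G A ->
    (\int[P]_(w in A) (u w)%:E <= \int[P]_(w in A) (v w)%:E)%E) ->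
  forall A, G A ->
    (\int[P]_(w in A) (u w * h w)%:E <= \int[P]_(w in A) (v w * h w)%:E)%E.
Proof.
move=> u0 v0 mu mv mh h01 le_uv A GA.
have h0 w : 0 <= h w by have /andP[/ltW] := h01 w.
have mhT := measurable_fun_sub_sigma_algebra mh.
have mA := sub_sigma_algebra_measurable GA.
apply: lee_mul_gt1 => [|c c1].
  by apply: integral_ge0 => w _; rewrite lee_fin mulr_ge0.
have c0 : 0 < c by lra.
rewrite -ge0_integralZl_EFin//; last 3 first.
- by move=> w _; rewrite lee_fin mulr_ge0.
- by apply/measurable_EFinP/measurable_funTS/measurable_funM.
- exact: ltW.
under [leRHS]eq_integral do rewrite -EFinM.
pose B n := [set w | c ^- n.+1 <= h w <= c ^- n].
apply: (@le_integral_of_countable_cover B) => //.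
- by move=> w; rewrite mulr_ge0.
- by move=> w; rewrite !mulr_ge0// ltW.
- exact: measurable_funM.
- by apply: measurable_funM => //; exact: measurable_funM.
- move=> n; rewrite -measurable_sub_sigma_algebra.
  have := mh measurableT `[c ^- n.+1, c ^- n]%classic (measurable_itv _).
  by rewrite setTI; congr (measurable _); apply/seteqP; split=> w /=; rewrite in_itv.
- move=> w; have /andP[hw0 hw1] := h01 w.
  have ex : exists n, c ^- n.+1 <= h w.
    have cV1 : `|c^-1| < 1 by rewrite ger0_norm ?invr_ge0 ?invf_lt1// ltW.
    have [n _ /(_ n.+1 (leqnSn n))] : \forall n \near \oo, c^-1 ^+ n < h w.
      exact: (cvgr_lt 0 (cvg_expr cV1)).
    by move=> hn; exists n; rewrite -exprVn ltW.
  case: (ex_minnP ex) => [[|m]] cm minm.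
    by exists 0%N; rewrite /B/= cm expr0 invr1 hw1.
  exists m.+1; rewrite /B/= cm/= leNgt; apply/negP => lt.
  by have := minm m (ltW lt); rewrite ltnn.
move=> n A' GA' A'B; have mA' := sub_sigma_algebra_measurable GA'.
have cn0 : 0 < c ^- n by rewrite invr_gt0 exprn_gt0.
apply: (@le_trans _ _ (\int[P]_(w in A') ((c ^- n)%:E * (u w)%:E))%E).
  apply: ge0_le_integral => //.
  - by move=> w _; rewrite lee_fin mulr_ge0.
  - by apply/measurable_EFinP/measurable_funTS/measurable_funM.
  - by apply: measurable_funeM; exact/measurable_EFinP/measurable_funTS.
  by move=> w /A'B /andP[_ hn]; rewrite -EFinM lee_fin mulrC ler_wpM2r.
rewrite ge0_integralZl_EFin//; last 3 first.
- by move=> w _; rewrite lee_fin.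
- by apply/measurable_EFinP/measurable_funTS.
- exact: ltW.
apply: le_trans (lee_wpmul2l _ (le_uv _ GA')) _; first by rewrite lee_fin ltW.
rewrite -ge0_integralZl_EFin//; last 3 first.
- by move=> w _; rewrite lee_fin.
- by apply/measurable_EFinP/measurable_funTS.
- exact: ltW.
apply: ge0_le_integral => //.
- by move=> w _; rewrite -EFinM lee_fin mulr_ge0// ltW.
- by apply: measurable_funeM; exact/measurable_EFinP/measurable_funTS.
- by apply/measurable_EFinP/measurable_funTS/measurable_funM => //; exact: measurable_funM.
move=> w /A'B /andP[hn _]; rewrite -EFinM lee_fin mulrCA mulrC ler_wpM2l//.
rewrite mulrC -ler_pdivrMr//.
by rewrite -[leLHS]/(c ^- n / c) -invfM -exprSr.
Qed.

End sub_sigma_algebra.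

(** * One step of the martingale *)

Lemma measurable_cosh (R : realType) (d : measure_display)
    (U : measurableType d) (h : U -> R) :
  measurable_fun setT h -> measurable_fun setT (fun w => cosh (h w)).
Proof.
move=> mh; apply: measurable_funM; last exact: measurable_cst.
apply: measurable_funD; apply: measurableT_comp => //.
exact: measurableT_comp.
Qed.

Section one_step.
Context (R : realType) (D : R) (X : completeNormedModType R).
Context (d : measure_display) (T : measurableType d) (P : probability T R).
Context (G : set (set T)) (f g : T -> X) (lambda : R).
Hypotheses (D_gt0 : 0 < D) (X_smooth : smooth2 X D) (X_separable : separable X).
Hypothesis lambda_gt0 : 0 < lambda.
Hypothesis sG : sub_sigma_algebra_of G.
Hypothesis g_cond : is_bochner_cond_exp P G f g.
Hypothesis f_int : bochner_integrable P setT f.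

Let excess w := expR (lambda * `|f w - g w|) - 1 - lambda * `|f w - g w|.

Hypothesis excess_int : P.-integrable setT (fun w => (excess w)%:E).

Variable e : T -> R.
Hypothesis e_cond : is_cond_exp P G excess e.

(** A version of a conditional expectation may be negative on a null set; with
   the positive part, the growth factor is at least [1] everywhere. *)
Let V w := 1 + D ^+ 2 * Num.max (e w) 0.

Let mfT : measurable_fun setT (f : T -> borel X). Proof. by case: f_int. Qed.
Let g_int : bochner_integrable P setT g. Proof. by case: g_cond. Qed.
Let mgT : measurable_fun setT (g : T -> borel X). Proof. by case: g_int. Qed.
Let meG : measurable_fun [set: g_sigma_algebraType G] (e : g_sigma_algebraType G -> R).
Proof. by case: e_cond. Qed.
Let meT : measurable_fun setT e.
Proof. exact: (measurable_fun_sub_sigma_algebra sG). Qed.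
Let e_int : P.-integrable setT (fun w => (e w)%:E). Proof. by case: e_cond. Qed.

Let mVT : measurable_fun setT V.
Proof.
apply: measurable_funD; first exact: measurable_cst.
by apply: measurable_funM; [exact: measurable_cst|exact: measurable_maxr].
Qed.

Let V_ge0 w : 0 <= V w.
Proof. by rewrite /V addr_ge0// mulr_ge0 ?sqr_ge0// le_max lexx orbT. Qed.

(** The linear term of the Taylor bound at a fixed point has mean zero on [G]. *)
Lemma integral_scalar_diff_eq0 (l : {scalar X}) (C : R) A :
  (forall v, `|l v| <= C * `|v|) -> G A ->
  (\int[P]_(w in A) (l (f w - g w))%:E = 0)%E.
Proof.
move=> lC GA; have mA := sub_sigma_algebra_measurable sG GA.
have iA h : bochner_integrable P setT h -> P.-integrable A (fun w => (l (h w))%:E).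
  by move=> hi; apply: integrableS (integrable_bounded_scalar X_separable lC hi).
under eq_integral do rewrite linearB EFinB.
rewrite integralB ?iA// -!(bochner_integral_scalar X_separable lC)//.
by case: g_cond => _ _ /(_ A GA) ->; rewrite -EFinB subrr.
Qed.

(** The conditional form of the Taylor bound, with [g] replaced by a constant
vector [x]: integrate the bound for [v = lambda (f - g)], drop the linear term,
and pass from the excess to its conditional expectation. *)
Lemma integral_cosh_shift_le (x : X) A : G A ->
  (\int[P]_(w in A) (cosh (lambda * `|x + (f w - g w)|))%:E <=
   \int[P]_(w in A) (cosh (lambda * `|x|) * V w)%:E)%E.
Proof.
move=> GA; have mA := sub_sigma_algebra_measurable sG GA.
have normZ (y : X) : lambda * `|y| = `|lambda *: y| by rewrite normrZ gtr0_norm.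
have [l [[C lC] hl]] := cosh_norm_expansion D_gt0 X_smooth (lambda *: x).
set K := cosh (lambda * `|x|); have K0 : 0 <= K by exact: cosh_ge0.
have iS (h : T -> \bar R) : P.-integrable setT h -> P.-integrable A h by exact: integrableS.
have iK : P.-integrable A (fun _ => K%:E) by exact: finite_measure_integrable_cst.
have iKZ (h : T -> R) : P.-integrable setT (fun w => (h w)%:E) ->
    P.-integrable A (fun w => (K + D ^+ 2 * K * h w)%:E).
  move=> hi; under eq_fun do rewrite EFinD (EFinM (D ^+ 2 * K)).
  apply: (integrableD mA iK (integrableZl mA (D ^+ 2 * K) _)); exact: iS.
have il : P.-integrable A (fun w => (lambda * l (f w - g w))%:E).
  under eq_fun do rewrite EFinM linearB EFinB.
  by apply: (integrableZl mA lambda (integrableB mA _ _)); apply: iS;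
    exact: (integrable_bounded_scalar X_separable lC).
have ie0 : P.-integrable setT (fun w => (Num.max (e w) 0)%:E).
  apply: le_integrable e_int => //.
    by apply/measurable_EFinP; exact: measurable_maxr.
  move=> w _; rewrite !abse_EFin lee_fin ger0_norm ?le_max ?lexx ?orbT//.
  by rewrite ge_max ler_norm normr_ge0.
apply: (@le_trans _ _ (\int[P]_(w in A)
    ((K + D ^+ 2 * K * excess w)%:E + (lambda * l (f w - g w))%:E))%E).
  apply: ge0_le_integral => //.
  - by move=> w _; rewrite lee_fin cosh_ge0.
  - apply/measurable_EFinP/measurable_funTS/measurable_cosh.
    apply: measurable_funM => //.
    have -> : (fun w => `|x + (f w - g w)|) = (fun w => `|f w - (g w - x)|).
      by apply/funext => w; congr `|_|; rewrite opprB addrCA.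
    by apply: measurable_norm_sub => //; exact: measurable_subr_cst.
  - by apply: emeasurable_funD; [case/integrableP: (iKZ _ excess_int)|case/integrableP: il].
  move=> w _; rewrite -EFinD lee_fin normZ scalerDr.
  apply: le_trans (hl _) _; rewrite -normZ -/K linearZ/= -normZ -/(excess w).
  by rewrite /GRing.scale/=; lra.
rewrite integralD ?iKZ//.
have -> : (\int[P]_(w in A) (lambda * l (f w - g w))%:E = 0)%E.
  under eq_integral do rewrite EFinM.
  rewrite integralZl//; first by rewrite (integral_scalar_diff_eq0 lC GA) mule0.
  under eq_fun do rewrite linearB EFinB.
  by apply: (integrableB mA); apply: iS; exact: (integrable_bounded_scalar X_separable lC).
rewrite adde0.
have -> : (\int[P]_(w in A) (K + D ^+ 2 * K * excess w)%:E =
           \int[P]_(w in A) (K + D ^+ 2 * K * e w)%:E)%E.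
  under eq_integral do rewrite EFinD (EFinM (D ^+ 2 * K)).
  under [RHS]eq_integral do rewrite EFinD (EFinM (D ^+ 2 * K)).
  rewrite !integralD//; [|by apply: integrableZl => //; exact: iS..].
  rewrite !integralZl//; [|by exact: iS..].
  by case: e_cond => _ _ ->.
apply: le_integral => //; first exact: iKZ.
  have -> : (fun w => (K * V w)%:E) = (fun w => (K + D ^+ 2 * K * Num.max (e w) 0)%:E).
    by apply/funext => w; congr (_%:E); rewrite /V; ring.
  exact: iKZ.
move=> w _; rewrite lee_fin /V mulrDr mulr1 lerD2l [leRHS]mulrCA -mulrA.
by rewrite ler_wpM2l ?sqr_ge0// ler_wpM2l// le_max lexx.
Qed.

Lemma cosh_scaled_add_le (x y : X) :
  cosh (lambda * `|x + y|) <= cosh (lambda * `|x|) * expR (lambda * `|y|).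
Proof.
have normZ (z : X) : lambda * `|z| = `|lambda *: z| by rewrite normrZ gtr0_norm.
by rewrite !normZ scalerDr; exact: cosh_norm_le.
Qed.

(** On the set where [|g - s n| < eps] the vector [g] is replaced by [s n]; this
costs a factor [q = e^(lambda eps)] once on each side, and [eps] is chosen so
that [q^2] is the prescribed [c > 1]. *)
Lemma integral_cosh_step_le A : G A ->
  (\int[P]_(w in A) (cosh (lambda * `|f w|))%:E <=
   \int[P]_(w in A) (V w * cosh (lambda * `|g w|))%:E)%E.
Proof.
move=> GA; have mA := sub_sigma_algebra_measurable sG GA.
have mn h : measurable_fun setT (h : T -> borel X) ->
    measurable_fun setT (fun w => cosh (lambda * `|h w|)).
  move=> mh; apply: measurable_cosh; apply: measurable_funM => //.
  by under eq_fun do rewrite -[h _]subr0; exact: measurable_norm_sub_cst.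
have mr : measurable_fun setT (fun w => V w * cosh (lambda * `|g w|)).
  by apply: measurable_funM => //; exact: mn.
have r0 w : 0 <= V w * cosh (lambda * `|g w|) by rewrite mulr_ge0// cosh_ge0.
apply: lee_mul_gt1 => [|c c1].
  by apply: integral_ge0 => w _; rewrite lee_fin.
have c0 : 0 < c by lra.
rewrite -ge0_integralZl_EFin//; last 3 first.
- by move=> w _; rewrite lee_fin.
- exact/measurable_EFinP/measurable_funTS.
- exact: ltW.
under [leRHS]eq_integral do rewrite -EFinM.
have [s sP] := separable_dense_seq X_separable.
pose q := expR (ln c / 2); have qq : q * q = c.
  by rewrite -expRD -splitr lnK// posrE.
have q0 : 0 <= q by exact: expR_ge0.
pose eps := ln c / 2 / lambda; have eps0 : 0 < eps by rewrite !divr_gt0// ln_gt0.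
have leps : lambda * eps = ln c / 2 by rewrite mulrC divfK// gt_eqF.
pose B n := [set w | `|g w - s n| < eps].
apply: (@le_integral_of_countable_cover _ _ _ _ _ sG B) => //.
- by move=> w; rewrite cosh_ge0.
- by move=> w; rewrite mulr_ge0// ltW.
- exact: mn.
- exact: measurable_funM.
- move=> n; rewrite -(measurable_sub_sigma_algebra sG).
  have mgG : measurable_fun [set: g_sigma_algebraType G] (g : g_sigma_algebraType G -> borel X).
    by case: g_cond.
  have h := measurable_norm_sub_cst (s n) mgG.
  have := h measurableT _ (@measurable_itv R `]-oo, eps[).
  by rewrite setTI; congr (measurable _); apply/seteqP; split=> w /=; rewrite in_itv.
- by move=> w; have [n] := sP (g w) eps eps0; exists n.
move=> n A' GA' A'B; have mA' := sub_sigma_algebra_measurable sG GA'.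
have gq w : A' w -> lambda * `|g w - s n| <= ln c / 2.
  by move=> /A'B /ltW h; rewrite -leps ler_wpM2l// ltW.
have mshift : measurable_fun setT (fun w => cosh (lambda * `|s n + (f w - g w)|)).
  apply: measurable_cosh; apply: measurable_funM => //.
  have -> : (fun w => `|s n + (f w - g w)|) = (fun w => `|f w - (g w - s n)|).
    by apply/funext => w; congr `|_|; rewrite opprB addrCA.
  by apply: measurable_norm_sub => //; exact: measurable_subr_cst.
apply: (@le_trans _ _ (\int[P]_(w in A')
    (q%:E * (cosh (lambda * `|s n + (f w - g w)|))%:E))%E).
  apply: ge0_le_integral => //.
  - by move=> w _; rewrite lee_fin cosh_ge0.
  - exact/measurable_EFinP/measurable_funTS/mn.
  - by apply: measurable_funeM; exact/measurable_EFinP/measurable_funTS.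
  move=> w Aw; rewrite -EFinM lee_fin.
  have fE : f w = s n + (f w - g w) + (g w - s n).
    by rewrite addrC addrA subrK subrKC.
  rewrite {1}fE.
  apply: le_trans (cosh_scaled_add_le _ _) _.
  have e1 : expR (lambda * `|g w - s n|) <= q by rewrite ler_expR gq.
  rewrite [leRHS](mulrC q); exact: ler_wpM2l (cosh_ge0 _) _ _ e1.
rewrite ge0_integralZl_EFin//; last 2 first.
- by move=> w _; rewrite lee_fin cosh_ge0.
- exact/measurable_EFinP/measurable_funTS.
apply: le_trans (lee_wpmul2l _ (integral_cosh_shift_le (s n) GA')) _.
  by rewrite lee_fin.
have mKV : measurable_fun setT (fun w => cosh (lambda * `|s n|) * V w).
  exact: measurable_funM.
rewrite -ge0_integralZl_EFin//; last 2 first.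
- by move=> w _; rewrite lee_fin mulr_ge0// cosh_ge0.
- exact/measurable_EFinP/measurable_funTS.
apply: ge0_le_integral => //.
- by move=> w _; rewrite -EFinM lee_fin !mulr_ge0// cosh_ge0.
- by apply: measurable_funeM; exact/measurable_EFinP/measurable_funTS.
- by apply/measurable_EFinP/measurable_funTS/measurable_funM.
move=> w Aw; rewrite -EFinM lee_fin -qq.
have h : cosh (lambda * `|s n|) <= cosh (lambda * `|g w|) * q.
  rewrite -[s n](subrKC (g w)); apply: le_trans (cosh_scaled_add_le _ _) _.
  by rewrite ler_wpM2l ?cosh_ge0// ler_expR distrC gq.
have := ler_wpM2l q0 (ler_wpM2r (V_ge0 w) h); lra.
Qed.

End one_step.

(** * The maximal inequality for nonnegative supermartingales *)

Section supermartingale.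
Context (R : realType) (d : measure_display) (T : measurableType d).
Variable P : probability T R.

Lemma cond_exp_ge0 (G : set (set T)) (Z Y : T -> R) :
  sub_sigma_algebra_of G -> (forall w, 0 <= Z w) -> is_cond_exp P G Z Y ->
  {ae P, forall w, 0 <= Y w}.
Proof.
move=> sG Z0 [mY iY YZ].
have mYT := measurable_fun_sub_sigma_algebra sG mY.
pose A := [set w | Y w < 0].
have GA : G A.
  rewrite -(measurable_sub_sigma_algebra sG).
  have := mY measurableT _ (@measurable_itv R `]-oo, 0[).
  by rewrite setTI; congr (measurable _); apply/seteqP; split=> w /=; rewrite in_itv.
have mA := sub_sigma_algebra_measurable sG GA.
have iYA : P.-integrable A (EFin \o Y) by exact: integrableS iY.
have : (\int[P]_(w in A) `|(EFin \o Y) w| = 0)%E.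
  apply/eqP; rewrite eq_le integral_ge0// andbT.
  have -> : (\int[P]_(w in A) `|(EFin \o Y) w| =
             - \int[P]_(w in A) (EFin \o Y) w)%E.
    rewrite -integralN; last by apply: integrable_add_def.
    apply: eq_integral => w; rewrite inE => Yw.
    by rewrite /= ltr0_norm.
  by rewrite YZ// oppe_le0 integral_ge0// => w _; rewrite lee_fin.
move=> /ae_eq_integral_abs -/(_ mA); case; first exact: measurable_int iYA.
move=> N [mN PN YN]; exists N; split => // w Yw; apply: YN => /= AY.
apply: Yw => /=; rewrite leNgt; apply/negP => Yw.
by have := AY Yw => -[Yw0]; rewrite Yw0 ltxx in Yw.
Qed.

(** With [H n] the event that some [B k] occurred for [k < n], the quantity
[c P(H n) + int_(~ H n) S n] does not increase with [n]: the mass of [S] on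
[B n \ H n] pays for the growth of [c P(H n)], and the rest is carried to time
[n + 1] by the supermartingale property on [~ H n.+1], which belongs to
[F n]. *)
Lemma supermartingale_maximal (F : nat -> set (set T)) (S : nat -> T -> R)
    (B : nat -> set T) (c : R) :
  filtration F -> (forall n w, 0 <= S n w) ->
  (forall n, measurable_fun setT (S n)) ->
  (forall n A, F n A ->
    (\int[P]_(w in A) (S n.+1 w)%:E <= \int[P]_(w in A) (S n w)%:E)%E) ->
  (\int[P]_w (S 0 w)%:E <= 1)%E -> 0 <= c -> (forall n, F n (B n)) ->
  (forall n, {ae P, forall w, B n w -> c <= S n w}) ->
  (c%:E * P (\bigcup_n B n) <= 1)%E.
Proof.
move=> [sF leF] S0 mS superS S01 c0 FB cS.
have mG n := measurable_sub_sigma_algebra (sF n).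
have mB n : measurable (B n).
  exact: (sub_sigma_algebra_measurable (sF n) (FB n)).
pose H n := \big[setU/set0]_(k < n) B k.
have FH n m : (n <= m.+1)%N -> F m (H n).
  move=> nm; rewrite -mG; apply: (@bigsetU_measurable _ (g_sigma_algebraType (F m))) => k _.
  rewrite mG; apply: leF (FB k); rewrite -ltnS; exact: leq_trans (ltn_ord k) nm.
have FHC n : F n (~` H n.+1).
  by rewrite -mG; apply: (@measurableC _ (g_sigma_algebraType (F n))); rewrite mG; exact: FH.
have mH n : measurable (H n) by exact: bigsetU_measurable.
have mHC n : measurable (~` H n) by exact: measurableC.
have HS n : H n.+1 = H n `|` B n by rewrite /H big_ord_recr.
have mSA n A : measurable_fun A (EFin \o S n).
  by apply/measurable_EFinP; exact: measurable_funTS.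
have inv n : (c%:E * P (H n) + \int[P]_(w in ~` H n) (S n w)%:E <= 1)%E.
  elim: n => [|n IH].
    by rewrite /H big_ord0 measure0 mule0 add0e setC0.
  apply: le_trans IH.
  have mBH : measurable (B n `\` H n) by exact: measurableD.
  have -> : (P (H n.+1) = P (H n) + P (B n `\` H n))%E.
    rewrite -measureU//; last by apply/seteqP; split => // w [Hw [_]]; apply.
    congr (P _); rewrite HS; apply/seteqP.
    by split => w /=; rewrite /setU/=; case: (EM (H n w)); tauto.
  have HCE : ~` H n = ~` H n.+1 `|` (B n `\` H n).
    rewrite HS; apply/seteqP.
    by split => w /=; rewrite /setU/setC/setD/=; case: (EM (B n w)); tauto.
  rewrite [in leRHS]HCE ge0_integral_setU//; last 3 first.
  - exact: mSA.
  - by move=> w _; rewrite lee_fin.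
  - by apply/disj_setPS => w [] /=; rewrite HS => h [Bn _]; apply: h; right.
  rewrite ge0_muleDr// -addeA leeD// addeC; apply: leeD; first exact: superS.
  rewrite -integral_cst//; apply: ae_ge0_le_integral => //.
  - by move=> w _; rewrite lee_fin.
  - exact: mSA.
  - by apply: filterS (cS n) => w cw [Bw _]; rewrite lee_fin; exact: cw.
have -> : \bigcup_n B n = \bigcup_n H n.
  apply/seteqP; split=> w [n _]; first by move=> Bn; exists n.+1 => //; rewrite HS; right.
  elim: n => [|n IH]; first by rewrite /H big_ord0.
  by rewrite HS => -[/IH|Bn] //; exists n.
have cH : P (H n) @[n --> \oo] --> P (\bigcup_n H n).
  apply: nondecreasing_cvg_mu => //; first exact: bigcup_measurable.
  by apply/nondecreasing_seqP => n; apply/subsetPset; rewrite HS; left.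
have cH' : (c%:E * P (H n) @[n --> \oo] --> c%:E * P (\bigcup_n H n))%E.
  by apply: cvgeZl.
rewrite -(cvg_lim _ cH')//; apply: lime_le; first by apply/cvg_ex; eexists; exact: cH'.
apply: nearW => n; apply: le_trans (inv n); rewrite leeDl// integral_ge0// => w _.
by rewrite lee_fin.
Qed.

End supermartingale.

(** * The exponential supermartingale *)

Lemma measurable_inv_gt0 (R : realType) (d : measure_display) (U : measurableType d)
    (h : U -> R) : (forall w, 0 < h w) -> measurable_fun setT h ->
  measurable_fun setT (fun w => (h w)^-1).
Proof.
move=> h0 mh; have -> : (fun w => (h w)^-1) = (fun w => expR (- ln (h w))).
  by apply/funext => w; rewrite expRN lnK// posrE.
apply: measurableT_comp => //; apply: measurable_funN.
by apply: measurableT_comp => //; exact: measurable_ln.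
Qed.

Section martingale_bound.
Context (R : realType) (D : R) (X : completeNormedModType R).
Context (d : measure_display) (T : measurableType d) (P : probability T R).
Context (F : nat -> set (set T)) (f : nat -> T -> X) (lambda : R).
Hypotheses (D_gt0 : 0 < D) (X_smooth : smooth2 X D) (X_separable : separable X).
Hypotheses (f_martingale : martingale0 P F f) (lambda_gt0 : 0 < lambda).
Hypothesis exp_moment : forall j : nat, (1 <= j)%N ->
  ('E_P[(fun w => expR (lambda * `|mdiff f j w|))] < +oo)%E.

Let e j w := cond_excess P F f lambda j w.
Let V j w := 1 + D ^+ 2 * Num.max (e j w) 0.
Let W n w := \prod_(1 <= j < n.+1) V j w.

Let F_filtration : filtration F. Proof. by case: f_martingale => -[]. Qed.
Let sF n : sub_sigma_algebra_of (F n). Proof. by case: F_filtration. Qed.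
Let f_adapted n : measurable_fun [set: g_sigma_algebraType (F n)]
  (f n : g_sigma_algebraType (F n) -> borel X).
Proof. by case: f_martingale => -[]. Qed.
Let f_int n : bochner_integrable P setT (f n).
Proof. by case: f_martingale => -[]. Qed.
Let f_cond n : is_bochner_cond_exp P (F n) (f n.+1) (f n).
Proof. by case: f_martingale => -[]. Qed.
Let f_measurable n : measurable_fun setT (f n : T -> borel X).
Proof. by case: (f_int n). Qed.

Let excess j w := expR (lambda * `|mdiff f j w|) - 1 - lambda * `|mdiff f j w|.

Let excess_ge0 j w : 0 <= excess j w.
Proof. by rewrite /excess; have := expR_ge1Dx (lambda * `|mdiff f j w|); lra. Qed.

Let excess_integrable n : P.-integrable setT (fun w => (excess n.+1 w)%:E).
Proof.
have mn : measurable_fun setT (fun w => lambda * `|mdiff f n.+1 w|).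
  by apply: measurable_funM => //; exact: measurable_norm_sub.
have mexp : measurable_fun setT (fun w => expR (lambda * `|mdiff f n.+1 w|)).
  exact: measurableT_comp.
apply: (@le_integrable _ _ _ P setT measurableT _
   (fun w => (expR (lambda * `|mdiff f n.+1 w|))%:E)).
- apply/measurable_EFinP; apply: measurable_funB => //; exact: measurable_funB.
- move=> w _; rewrite !abse_EFin lee_fin ger0_norm ?excess_ge0//.
  rewrite ger0_norm ?expR_ge0// /excess.
  have : 0 <= lambda * `|mdiff f n.+1 w| by rewrite mulr_ge0// ltW.
  by lra.
apply/integrableP; split; first exact/measurable_EFinP.
have := @exp_moment n.+1 isT; rewrite unlock; apply: le_lt_trans.
rewrite le_eqVlt; apply/orP; left; apply/eqP; apply: eq_integral => w _.
by rewrite abse_EFin ger0_norm// expR_ge0.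
Qed.

Let e_cond n : is_cond_exp P (F n) (excess n.+1) (e n.+1).
Proof. exact: cond_expP (sF n) (excess_integrable n). Qed.

Let V_ge1 j w : 1 <= V j w.
Proof. by rewrite /V lerDl mulr_ge0 ?sqr_ge0// le_max lexx orbT. Qed.

Let WS n w : W n.+1 w = W n w * V n.+1 w.
Proof. by rewrite /W big_nat_recr. Qed.

Let W_ge1 n w : 1 <= W n w.
Proof.
elim: n => [|n IH]; first by rewrite /W big_nil.
by rewrite WS -[leLHS]mulr1 ler_pM.
Qed.

Let W_gt0 n w : 0 < W n w. Proof. exact: lt_le_trans ltr01 (W_ge1 n w). Qed.

Let W_predictable n m : (n <= m.+1)%N ->
  measurable_fun [set: g_sigma_algebraType (F m)]
    (W n : g_sigma_algebraType (F m) -> R).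
Proof.
elim: n => [_|n IH nm].
  have -> : W 0 = cst 1 by apply/funext => w; rewrite /W big_nil.
  exact: measurable_cst.
have -> : W n.+1 = (fun w => W n w * V n.+1 w) by apply/funext => w; rewrite WS.
apply: measurable_funM; first exact: IH (ltnW nm).
apply: measurable_funD; first exact: measurable_cst.
apply: measurable_funM; first exact: measurable_cst.
apply: measurable_maxr; last exact: measurable_cst.
have [me _ _] := e_cond n; move=> _ B mB.
have [_ leF] := F_filtration.
rewrite (measurable_sub_sigma_algebra (sF m)).
apply: (leF n m); first by rewrite -ltnS.
rewrite -(measurable_sub_sigma_algebra (sF n)); exact: me.
Qed.

Let W_measurable n : measurable_fun setT (W n).
Proof. exact: (measurable_fun_sub_sigma_algebra (sF n) (W_predictable (leqnSn n))). Qed.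

Let normf_measurable n : measurable_fun setT (fun w => `|f n w|).
Proof. by under eq_fun do rewrite -[f n _]subr0; exact: measurable_norm_sub_cst. Qed.

Let coshf_measurable n : measurable_fun setT (fun w => cosh (lambda * `|f n w|)).
Proof. by apply: measurable_cosh; exact: measurable_funM. Qed.

(** The weight [1 / W n.+1] is measurable at time [n], so it may multiply the
one-step inequality; its last factor cancels the growth factor there. *)
Lemma cosh_supermartingale n A : F n A ->
  (\int[P]_(w in A) (cosh (lambda * `|f n.+1 w|) / W n.+1 w)%:E <=
   \int[P]_(w in A) (cosh (lambda * `|f n w|) / W n w)%:E)%E.
Proof.
move=> FA.
have step := integral_cosh_step_le D_gt0 X_smooth X_separable lambda_gt0
  (sF n) (f_cond n) (f_int n.+1) (excess_integrable n) (e_cond n).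
have -> : (\int[P]_(w in A) (cosh (lambda * `|f n w|) / W n w)%:E =
  \int[P]_(w in A) (V n.+1 w * cosh (lambda * `|f n w|) * (W n.+1 w)^-1)%:E)%E.
  apply: eq_integral => w _; congr (_%:E); rewrite WS.
  have := W_gt0 n w; have := V_ge1 n.+1 w => V1 W0; field.
  by rewrite !gt_eqF//; lra.
apply: (@le_integral_weight _ _ _ P _ (sF n)) => //.
- by move=> w; exact: cosh_ge0.
- by move=> w; rewrite mulr_ge0 ?cosh_ge0//; have := V_ge1 n.+1 w; lra.
- apply: measurable_funM => //; apply: measurable_funD => //.
  apply: measurable_funM => //; apply: measurable_maxr => //.
  by have [me _ _] := e_cond n; exact: measurable_fun_sub_sigma_algebra me.
- exact: measurable_inv_gt0 (W_predictable (leqnn n.+1)).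
- by move=> w; rewrite invr_gt0 W_gt0 invf_le1// W_ge1.
Qed.

(** On the crossing event [cosh (lambda |f n|) / W n] is at least
[c = e^(lambda theta) / (2 M)], because [cosh t >= e^t / 2]. *)
Lemma crossing_probability_le (M theta : R) : 0 < M ->
  (forall n, {ae P, forall w, W n w <= M}) ->
  (P (\bigcup_n [set w | (theta < `|f n w|)%R]) <=
   (2 * expR (- (lambda * theta)) * M)%:E)%E.
Proof.
move=> M0 WM; pose c := expR (lambda * theta) / (2 * M).
have c0 : 0 < c by rewrite divr_gt0 ?expR_gt0// mulr_gt0.
have -> : 2 * expR (- (lambda * theta)) * M = c^-1.
  by rewrite /c expRN invf_div mulrAC.
rewrite -[leRHS]mule1 -lee_pdivrMl ?invr_gt0// invrK.
apply: (supermartingale_maximal (S := fun n w => cosh (lambda * `|f n w|) / W n w)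
  F_filtration) => //.
- by move=> n w; rewrite divr_ge0 ?cosh_ge0// ltW.
- by move=> n; apply: measurable_funM => //; exact: measurable_inv_gt0.
- exact: cosh_supermartingale.
- under eq_integral => w _.
    rewrite /W big_nil (proj2 f_martingale w) normr0 mulr0 cosh0 divr1.
    over.
  by rewrite integral_cst// mul1e probability_le1.
- exact: ltW.
- move=> n; rewrite -(measurable_sub_sigma_algebra (sF n)).
  have mfn := measurable_norm_sub_cst (0 : X) (@f_adapted n).
  have := mfn measurableT _ (@measurable_itv R `]theta, +oo[).
  rewrite setTI; congr (measurable _).
  by apply/seteqP; split=> w /=; rewrite in_itv/= andbT subr0.
move=> n; apply: filterS (WM n) => w Ww theta_lt.
rewrite ler_pdivlMr//; apply: le_trans (expR_le_cosh _).
apply: (@le_trans _ _ (expR (lambda * theta) / 2)); last first.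
  by rewrite ler_pM2r// ler_expR ler_pM2l// ltW.
have -> : expR (lambda * theta) / 2 = c * M by rewrite /c; field; rewrite gt_eqF.
by rewrite ler_pM2l.
Qed.

(** The supremum can reach [r] without being attained, so [r] is replaced by a
level [theta < r] at which some [|f n|] is above; [theta] is chosen so that the
bound deteriorates by exactly the factor [c]. *)
Lemma maximal_tail_le (M r : R) : 0 < M ->
  (forall n, {ae P, forall w, W n w <= M}) ->
  (P [set w | r%:E <= maximal f w] <= (2 * expR (- (lambda * r)) * M)%:E)%E.
Proof.
move=> M0 WM.
have K0 : 0 <= 2 * expR (- (lambda * r)) * M by rewrite !mulr_ge0 ?expR_ge0// ltW.
apply: lee_mul_gt1 => [|c c1]; first by rewrite lee_fin.
pose theta := r - ln c / lambda.
have lc0 : 0 < ln c by rewrite ln_gt0.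
have tr : theta < r by rewrite /theta ltrBlDr ltrDl divr_gt0.
have -> : (c%:E * (2 * expR (- (lambda * r)) * M)%:E =
           (2 * expR (- (lambda * theta)) * M)%:E)%E.
  have -> : - (lambda * theta) = - (lambda * r) + ln c.
    by rewrite /theta; field; rewrite gt_eqF.
  by rewrite expRD lnK ?posrE ?(lt_trans _ c1)// -EFinM; congr (_%:E); ring.
apply: le_trans (crossing_probability_le theta M0 WM).
apply: le_measure; rewrite ?inE.
- have -> : maximal f = (fun w => esups (fun n => (`|f n w|)%:E) 0).
    apply/funext => w; rewrite /maximal /esups/=; congr ereal_sup.
    by apply/seteqP; split => _ [n _ <-]; exists n.
  rewrite -[X in measurable X]setTI.
  apply: emeasurable_fun_c_infty => //; apply: measurable_fun_esups => n.
  exact/measurable_EFinP.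
- apply: bigcup_measurable => n _; rewrite -[X in measurable X]setTI.
  have h := @normf_measurable n; have := h measurableT _ (@measurable_itv R `]theta, +oo[).
  congr (measurable _).
  by apply/seteqP; split=> w /=; rewrite in_itv/= andbT.
move=> w /= rf; have : (theta%:E < maximal f w)%E by apply: lt_le_trans rf; rewrite lte_fin.
by move=> /ereal_sup_gt[_ [n _ <-]]; rewrite lte_fin => h; exists n.
Qed.

Lemma cond_excess_ge0 : {ae P, forall w, forall n, 0 <= e n.+1 w}.
Proof.
by apply: ae_foralln => n; exact: cond_exp_ge0 (sF n) (excess_ge0 n.+1) (e_cond n).
Qed.

Let U n w : R := \prod_(1 <= j < n.+1) (1 + D ^+ 2 * e j w).

Let W_eq_U w : (forall n, 0 <= e n.+1 w) -> forall n, W n w = U n w.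
Proof.
move=> e0 n; rewrite /W /U; apply: eq_big_nat => -[//|j] _.
by rewrite /V max_l.
Qed.

Lemma growth_le_lim w : (forall n, 0 <= e n.+1 w) ->
  forall n, ((W n w)%:E <= limn (fun n => (U n w)%:E))%E.
Proof.
move=> e0 n; have -> : (fun n => (U n w)%:E) = (fun n => (W n w)%:E).
  by apply/funext => k; rewrite W_eq_U.
have nd : nondecreasing_seq (fun n => (W n w)%:E).
  apply/nondecreasing_seqP => k; rewrite lee_fin WS.
  by rewrite ler_peMr// ltW.
rewrite (cvg_lim _ (ereal_nondecreasing_cvgn nd))//.
by apply: ereal_sup_ubound; exists n.
Qed.

(** This is [1 + x <= e^x], factor by factor. *)
Lemma lim_growth_le w (S : R) : (forall n, 0 <= e n.+1 w) ->
  (\sum_(1 <= j <oo) (e j w)%:E <= S%:E)%E ->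
  (`|limn (fun n => (U n w)%:E)| <= (expR (D ^+ 2 * S))%:E)%E.
Proof.
move=> e0 eS.
have lim0 : (0 <= limn (fun n => (U n w)%:E))%E.
  by apply: le_trans (growth_le_lim e0 0); rewrite lee_fin ltW.
have US n : (U n w <= expR (D ^+ 2 * S)).
  apply: (@le_trans _ _ (expR (D ^+ 2 * \sum_(1 <= j < n.+1) e j w))).
    rewrite mulr_sumr expR_sum /U big_nat_cond [leRHS]big_nat_cond.
    apply: ler_prod => -[//|j] _.
    by rewrite expR_ge1Dx andbT addr_ge0// mulr_ge0 ?sqr_ge0.
  rewrite ler_expR ler_wpM2l ?sqr_ge0// -lee_fin -sumEFin.
  apply: le_trans eS; apply: nneseries_lim_ge => -[//|j] _ _.
  by rewrite lee_fin.
rewrite gee0_abs//; apply: lime_le; last by apply: nearW => n; rewrite lee_fin.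
have -> : (fun n => (U n w)%:E) = (fun n => (W n w)%:E).
  by apply/funext => k; rewrite W_eq_U.
apply: ereal_nondecreasing_is_cvgn; apply/nondecreasing_seqP => k.
by rewrite lee_fin WS ler_peMr// ltW.
Qed.

End martingale_bound.

Lemma LnormyE (R : realType) (d : measure_display) (T : measurableType d)
    (P : probability T R) (h : T -> \bar R) :
  ('N[P]_+oo[h] = ess_sup P (abse \o h))%E.
Proof.
rewrite unlock /Lnorm ifT//.
exact: (eq_ind_r (fun x => 0 < x)%E lte01 (@probability_setT _ _ _ P)).
Qed.

Theorem theorem3p1 (R : realType) (D : R) (X : completeNormedModType R)
    (d : measure_display) (T : measurableType d) (P : probability T R)
    (F : nat -> set (set T)) (f : nat -> T -> X) (lambda : R)
    (D_gt0 : 0 < D) (X_smooth : smooth2 X D) (X_separable : separable X)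
    (f_martingale : martingale0 P F f) (lambda_gt0 : 0 < lambda)
    (exp_moment : forall j : nat, (1 <= j)%N ->
      ('E_P[(fun w => expR (lambda * `|mdiff f j w|))] < +oo)%E)
    (r : R) (r_ge0 : 0 <= r) :
  (P [set w | r%:E <= maximal f w] <=
     (2 * expR (- (lambda * r)))%:E *
     'N[P]_+oo[(fun w => limn (fun n =>
        (\prod_(1 <= j < n.+1)
           (1 + D ^+ 2 * cond_excess P F f lambda j w)%R)%:E))])%E
  /\
  ((2 * expR (- (lambda * r)))%:E *
     'N[P]_+oo[(fun w => limn (fun n =>
        (\prod_(1 <= j < n.+1)
           (1 + D ^+ 2 * cond_excess P F f lambda j w)%R)%:E))] <=
   2%:E * expeR ((- (lambda * r))%:E +
     (D ^+ 2)%:E *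
     'N[P]_+oo[(fun w =>
        \sum_(1 <= j <oo) (cond_excess P F f lambda j w)%:E)]))%E.
Proof.
have ae_e0 := cond_excess_ge0 X_separable f_martingale lambda_gt0 exp_moment.
have P_gt0 : (0 < P setT)%E.
  exact: (eq_ind_r (fun x => 0 < x)%E lte01 (@probability_setT _ _ _ P)).
have k_gt0 : 0 < 2 * expR (- (lambda * r)) by rewrite mulr_gt0// expR_gt0.
set N := ('N[P]_+oo[_])%E; set S := ('N[P]_+oo[(fun w => \sum_(1 <= j <oo) _)])%E.
have D2 : 0 < D ^+ 2 by rewrite exprn_gt0.
split.
  case EN : N => [M| |].
  - have WN n : {ae P, forall w, (\prod_(1 <= j < n.+1)
        (1 + D ^+ 2 * Num.max (cond_excess P F f lambda j w) 0)) <= M}.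
      have hN := ess_sup_ge P (abse \o (fun w => limn (fun n =>
        (\prod_(1 <= j < n.+1) (1 + D ^+ 2 * cond_excess P F f lambda j w)%R)%:E))).
      rewrite -LnormyE -/N EN in hN.
      apply: filterS2 ae_e0 hN => w e0 hw; rewrite -lee_fin.
      apply: le_trans hw; apply: le_trans (lee_abs _).
      exact: growth_le_lim.
    have M_gt0 : 0 < M.
      have : (1 <= M%:E)%E.
        rewrite -(ess_sup_cst 1%E P_gt0); apply/ess_supP.
        by apply: filterS (WN 0) => w; rewrite big_nil lee_fin.
      by rewrite lee_fin; apply: lt_le_trans.
    rewrite -EFinM; exact: maximal_tail_le WN.
  - by rewrite gt0_muley ?lte_fin// leey.
  - have := Lnorm_ge0 P +oo%E (fun w => limn (fun n =>
        (\prod_(1 <= j < n.+1)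
           (1 + D ^+ 2 * cond_excess P F f lambda j w)%R)%:E)).
    by rewrite -/N EN.
have S_ge0 : (0 <= S)%E by exact: Lnorm_ge0.
case ES : S S_ge0 => [s| |]// _.
  rewrite -(EFinM (D ^+ 2)) -(EFinD (- (lambda * r))) /= -(EFinM 2).
  rewrite expRD mulrA EFinM lee_pmul2l ?lte_fin//.
  rewrite /N LnormyE; apply/ess_supP.
  have hS := ess_sup_ge P (abse \o (fun w =>
    (\sum_(1 <= j <oo) (cond_excess P F f lambda j w)%:E)%E)).
  rewrite -LnormyE -/S ES in hS.
  apply: filterS2 ae_e0 hS => w e0 hw /=.
  apply: lim_growth_le => //; exact: le_trans (lee_abs _) hw.
by rewrite gt0_muley ?lte_fin// addey// /= gt0_muley ?lte_fin// leey.
Qed.
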